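(* Let $\mathfrak{H}$ be a separable Hilbert space with an orthogonal decomposition $\mathfrak{H}=\mathfrak{H}_0\oplus\mathfrak{H}_1$, let $A_0$, $A_1$ be bounded self-adjoint operators on $\mathfrak{H}_0$, $\mathfrak{H}_1$ respectively, let $V:\mathfrak{H}_1\to\mathfrak{H}_0$ be a bounded operator, and let $\lambda\in\mathbb{R}$ satisfy $\sup\mathrm{spec}(A_0)\le\lambda\le\inf\mathrm{spec}(A_1)$. Put $$\mathbf{B}=\begin{pmatrix}A_0&V\\ V^*&A_1\end{pmatrix},\qquad \mathfrak{Q}=\mathrm{Ran}\,\mathsf{E}_{\mathbf{B}}((-\infty,\lambda))\oplus\big(\mathrm{Ran}\,\mathsf{E}_{\mathbf{B}}(\{\lambda\})\cap\mathfrak{H}_0\big).$$ Let $Q$ be the orthogonal projection in $\mathfrak{H}$ onto $\mathfrak{Q}$ and $P$ the orthogonal projection in $\mathfrak{H}$ onto $\mathfrak{H}_0$. Then: (i) $\|P-Q\|\le\frac{\sqrt2}{2}$. (ii) If either $\mathrm{Ker}(A_0-\lambda)=\{0\}$ or $\mathrm{Ker}(A_1-\lambda)=\{0\}$, then neither $\frac{\sqrt2}{2}$ nor $-\frac{\sqrt2}{2}$ is an eigenvalue of $P-Q$. (iii) If $d=\mathrm{dist}(\mathrm{spec}(A_0),\mathrm{spec}(A_1))>0$, then $$\|P-Q\|\le\sin\left(\frac12\arctan\frac{2\|V\|}{d}\right)<\frac{\sqrt2}{2}.$$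
   Context: $\mathrm{spec}(T)$ denotes the spectrum of $T$, and $\mathsf{E}_{\mathbf{B}}(\Delta)$ the spectral projection of the self-adjoint operator $\mathbf{B}$ for the Borel set $\Delta\subset\mathbb{R}$. Subspaces of $\mathfrak{H}_0$ and $\mathfrak{H}_1$ are regarded as subspaces of $\mathfrak{H}$ in the natural way. *)

(* Defs.v *)
From HB Require Import structures.
From mathcomp Require Import all_boot all_order all_algebra.
From mathcomp Require Import complex.
From mathcomp Require Import all_classical all_reals all_analysis.

Set Implicit Arguments.
Unset Strict Implicit.
Unset Printing Implicit Defensive.

Import Order.TTheory GRing.Theory Num.Theory numFieldNormedType.Exports.

Local Open Scope classical_set_scope.
Local Open Scope complex_scope.
Local Open Scope ring_scope.

(* [inner] is linear in its first argument and antilinear in its second.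
   The norm of a normed module over R[i] takes its (nonnegative real) values
   in R[i]. *)
HB.mixin Record CompleteNormedModule_isHilbert (R : realType) H
    of CompleteNormedModule R[i] H := {
  inner : {dot H for Num.conj} ;
  normr2_inner : forall x : H, `|x| ^+ 2 = inner x x
}.

#[short(type="hilbertType")]
HB.structure Definition Hilbert (R : realType) :=
  {H of CompleteNormedModule_isHilbert R H & CompleteNormedModule R[i] H}.

Definition separable (T : topologicalType) : Prop :=
  exists2 D : set T, countable D & dense D.

Section Operators.
Variables (R : realType) (H K : hilbertType R).

Definition bounded_operator (T : H -> K) : Prop :=
  exists M : R, forall x, `|T x| <= M%:C * `|x|.

(* Meaningful for bounded T only: [sup] is 0 on unbounded sets. *)
Definition opnorm (T : H -> K) : R :=
  sup [set complex.Re `|T x| | x in [set x : H | `|x| <= 1]].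

Definition is_adjoint (T : H -> K) (Tstar : K -> H) : Prop :=
  forall x y, inner (T x) y = inner x (Tstar y).

End Operators.

Section Endomorphisms.
Variables (R : realType) (H : hilbertType R).

Definition self_adjoint (T : H -> H) : Prop := is_adjoint T T.

Definition resolvent_set (T : H -> H) : set R[i] :=
  [set z | exists S : {linear H -> H},
     [/\ bounded_operator S,
         cancel (fun x => T x - z *: x) S &
         cancel S (fun x => T x - z *: x)]].

Definition spectrum (T : H -> H) : set R[i] := ~` resolvent_set T.

(* The spectrum of a self-adjoint operator is contained in R, so that nothing
   is lost by regarding it as a subset of R. *)
Definition real_spectrum (T : H -> H) : set R := [set t | spectrum T t%:C].

(* The supremum and the infimum are extended real numbers, so that the empty
   spectrum of the operator on the zero space has supremum -oo and infimum
   +oo, and is at distance +oo from any set. *)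
Definition sup_spec (T : H -> H) : \bar R := ereal_sup (EFin @` real_spectrum T).

Definition inf_spec (T : H -> H) : \bar R := ereal_inf (EFin @` real_spectrum T).

Definition Ker (T : H -> H) : set H := [set x | T x = 0].

Definition is_eigenvalue (T : H -> H) (z : R[i]) : Prop :=
  exists2 x, x != 0 & T x = z *: x.

Definition projection_onto (M : set H) (P : H -> H) : Prop :=
  forall x, M (P x) /\ forall y, M y -> inner (x - P x) y = 0.

(* Only the values of E at Borel sets are constrained. *)
Record projection_valued_measure (E : set R -> {linear H -> H}) : Prop := {
  pvm_idem : forall A, measurable A -> forall x, E A (E A x) = E A x ;
  pvm_self_adjoint : forall A, measurable A -> self_adjoint (E A) ;
  pvm_set0 : forall x, E set0 x = 0 ;
  pvm_setT : forall x, E setT x = x ;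
  pvm_setI : forall A B, measurable A -> measurable B ->
    forall x, E (A `&` B) x = E A (E B x) ;
  pvm_sigma_additive : forall F : nat -> set R,
    (forall n, measurable (F n)) -> trivIset setT F ->
    forall x, (fun n => \sum_(k < n) E (F k) x) @ \oo --> E (\bigcup_n F n) x
}.

(* E is the spectral measure of the bounded self-adjoint operator T, that is
   T = \int t dE(t) : for every x, with mu the measure A |-> <E(A) x, x>,
   <T x, x> = \int t dmu(t). By the spectral theorem E exists and is unique
   on the Borel sets. *)
Definition spectral_measure (T : H -> H) (E : set R -> {linear H -> H}) : Prop :=
  projection_valued_measure E /\
  forall x, exists mu : {finite_measure set R -> \bar R},
    [/\ forall A, measurable A -> mu A = (complex.Re (inner (E A x) x))%:E,
        mu.-integrable setT (fun t : R => t%:E) &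
        inner (T x) x = (\int[mu]_t (t : R))%:C].

End Endomorphisms.

Definition spec_dist (R : realType) (H K : hilbertType R)
    (S : H -> H) (T : K -> K) : \bar R :=
  ereal_inf [set `|s - t|%:E | s in real_spectrum S & t in real_spectrum T].

(* H is the orthogonal sum of H0 and H1, which are regarded as subspaces of H
   by means of the isometric embeddings j0 and j1. *)
Record orthogonal_decomposition (R : realType) (H H0 H1 : hilbertType R)
    (j0 : {linear H0 -> H}) (j1 : {linear H1 -> H}) : Prop := {
  decomp_isometry0 : forall x y, inner (j0 x) (j0 y) = inner x y ;
  decomp_isometry1 : forall x y, inner (j1 x) (j1 y) = inner x y ;
  decomp_orthogonal : forall x y, inner (j0 x) (j1 y) = 0 ;
  decomp_total : forall z, exists x y, z = j0 x + j1 y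
}.

Definition block_operator (R : realType) (H H0 H1 : hilbertType R)
    (j0 : H0 -> H) (j1 : H1 -> H) (A0 : H0 -> H0) (V : H1 -> H0)
    (Vstar : H0 -> H1) (A1 : H1 -> H1) (B : H -> H) : Prop :=
  forall x y, B (j0 x + j1 y) = j0 (A0 x + V y) + j1 (Vstar x + A1 y).

Definition frakQ (R : realType) (H H0 : hilbertType R) (j0 : H0 -> H)
    (E : set R -> {linear H -> H}) (lambda : R) : set H :=
  [set u + v | u in range (E `]-oo, lambda[%classic)
             & v in range (E [set lambda]) `&` range j0].

(* Main.v *)
Require Import Defs.
From mathcomp Require Import all_boot all_order all_algebra.
From mathcomp Require Import complex.
From mathcomp Require Import all_classical all_reals all_analysis.
From mathcomp Require Import ring lra.

(** Let [N = B - lambda] and let [J = 2 P - 1] be the reflection that is [1] on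
[H0] and [-1] on [H1]. The off-diagonal entries of [N] cancel in the real part
of the form of [J N], which leaves [<N x0, x0> - <N x1, x1> <= 0] for the
components [x0], [x1] of [x] in [H0] and [H1]. Hence [<J x, x>] does not
increase along the flow [x |-> exp (t N) x]. If [x] lies in the spectral
subspace of [B] for the half line below [lambda], then this flow tends to [0],
so [<J x, x> >= 0]. The part of the kernel of [N] that belongs to [frakQ] lies
in [H0], where [J = 1]. Thus [|x1| <= |x0|] on [frakQ]. The kernel of [N] is
the direct sum of its intersections with [H0] and [H1] ([kernel_split]), so the
same argument for [- N] and [- J] gives [|x0| <= |x1|] on the orthogonal
complement of [frakQ]. Now (i) follows from
[|(P - Q) x|^2 = |P (x - Q x)|^2 + |(1 - P) Q x|^2].

The flow is replaced by the iteration of [x |-> x + h N x] for small [h]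
([decreasing_form_ge0]), and the limit by the remark that a bound on a form
which can always be improved down to [a] is a bound by [a]
([bound_of_improvement]).

For (ii), an eigenvector for [sqrt 2 / 2] or [- sqrt 2 / 2] has components [x]
in [frakQ] and in its complement with [<J x, x> = 0]. As [J] is semidefinite
there and [N] leaves both subspaces invariant, [<J x, N x> = 0]; then [x0] and
[x1] lie in the kernels of [A0 - lambda] and [A1 - lambda]
([isotropic_half]), and their norms are equal, so that [x = 0] as soon as one of
these kernels is trivial.

For (iii), let [A0 <= a] and [b <= A1] with [a < b]. First [B <= a] on [frakQ]
([half_below_gap]): if [r > a] is the supremum of the form of [B] on [frakQ],
then there are unit vectors [x] of [frakQ] with [(B - r) x] small, while
[<J x, (B - r) x>] stays away from [0]. So the flow of [B - (a + b) / 2] tends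
to [0] on [frakQ], and it can be used with [J - c] instead of [J]: the cross
term, now present, is dominated by the diagonal terms exactly for
[c <= cos (2 theta)] with [tan (2 theta) = 2 |V| / (b - a)]
([reflection_gap_ge0]). The resulting inequality
[|x1|^2 <= (1 - c) / 2 * |x|^2 = sin^2 theta * |x|^2] on [frakQ], with its
analogue on the complement, is (iii).

Since only real parts of inner products matter, the Hilbert spaces are treated
as real inner product spaces by means of [rdot x y = Re <x, y>]. *)

Set Implicit Arguments.
Unset Strict Implicit.
Unset Printing Implicit Defensive.

Import Order.TTheory GRing.Theory Num.Theory numFieldNormedType.Exports.

Local Open Scope classical_set_scope.
Local Open Scope complex_scope.
Local Open Scope ring_scope.

(** * Real quadratic polynomials and improvable bounds *)

Section RealQuadratics.
Variable R : realType.
Implicit Types a b c : R.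

Lemma discriminant_le a b c : 0 <= c ->
  (forall t, 0 <= a + 2 * t * b + t ^+ 2 * c) -> b ^+ 2 <= a * c.
Proof.
move=> c0 h; have [c_eq0|c_neq0] := eqVneq c 0.
  have [->|b0] := eqVneq b 0; first by rewrite c_eq0 mulr0 expr0n.
  have := h (- (a + 1) / (2 * b)); rewrite c_eq0 !mulr0 addr0.
  have -> : a + 2 * (- (a + 1) / (2 * b)) * b = -1 by field; rewrite b0.
  by rewrite lerNr oppr0 ler10.
have cp : 0 < c by rewrite lt_def c_neq0.
have := h (- b / c).
have -> : a + 2 * (- b / c) * b + (- b / c) ^+ 2 * c = (a * c - b ^+ 2) / c.
  by field.
by rewrite pmulr_lge0 ?invr_gt0// subr_ge0.
Qed.

Lemma quadratic_ge0 a b c p q : 0 <= a -> 0 <= c -> b ^+ 2 <= a * c ->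
  0 <= a * p ^+ 2 + 2 * b * p * q + c * q ^+ 2.
Proof.
move=> a0 c0 h; have [a_eq0|a_neq0] := eqVneq a 0.
  have : b ^+ 2 <= 0 by rewrite a_eq0 mul0r in h.
  rewrite le_eqVlt ltNge sqr_ge0 orbF sqrf_eq0 => /eqP ->.
  by rewrite a_eq0 mul0r mulr0 !mul0r !add0r mulr_ge0 ?sqr_ge0.
have ap : 0 < a by rewrite lt_def a_neq0.
rewrite -(pmulr_rge0 _ ap).
have -> : a * (a * p ^+ 2 + 2 * b * p * q + c * q ^+ 2) =
  (a * p + b * q) ^+ 2 + (a * c - b ^+ 2) * q ^+ 2 by ring.
by rewrite addr_ge0 ?sqr_ge0// mulr_ge0 ?sqr_ge0// subr_ge0.
Qed.

(** The least [r] with [q <= r * n] on [S] is itself such a bound, so it cannot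
exceed [a]. *)
Lemma bound_of_improvement (T : Type) (S : T -> Prop) (q n : T -> R) a r0 :
  (forall x, 0 <= n x) -> a <= r0 ->
  (forall x, S x -> q x <= r0 * n x) ->
  (forall r, a < r <= r0 -> (forall x, S x -> q x <= r * n x) ->
     exists2 r', r' < r & forall x, S x -> q x <= r' * n x) ->
  forall x, S x -> q x <= a * n x.
Proof.
move=> n0 ar0 hr0 improve x Sx; rewrite leNgt; apply/negP => qx.
have nx : 0 < n x.
  rewrite lt_def n0 andbT; apply/eqP => nx0.
  by have := hr0 _ Sx; rewrite leNgt (le_lt_trans _ qx)// nx0 !mulr0.
pose Z := [set r | forall x, S x -> q x <= r * n x].
have Zlb y : S y -> 0 < n y -> lbound Z (q y / n y).
  by move=> Sy ny r Zr; rewrite ler_pdivrMr// Zr.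
have Zinf : has_inf Z by split; [exists r0|exists (q x / n x); exact: Zlb].
have ZM : Z (inf Z).
  move=> y Sy; have [ny0|ny0] := eqVneq (n y) 0.
    by have := hr0 _ Sy; rewrite ny0 !mulr0.
  have ny : 0 < n y by rewrite lt_def ny0 n0.
  by rewrite -ler_pdivrMr// lb_le_inf//; [exists r0|exact: Zlb].
have aM : a < inf Z.
  apply: (@lt_le_trans _ _ (q x / n x)); first by rewrite ltr_pdivlMr.
  by apply: lb_le_inf; [exists r0|exact: Zlb].
have Mr0 : inf Z <= r0 by apply: ge_inf; [case: Zinf|].
have [|r' r'M Zr'] := improve (inf Z) _ ZM; first by rewrite aM.
by have := r'M; rewrite ltNge ge_inf//; case: Zinf.
Qed.

End RealQuadratics.

(** * The real inner product *)

Section RealInnerProduct.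
Variables (R : realType) (H : hilbertType R).
Implicit Types (x y z : H) (t : R).

Definition rdot x y : R := complex.Re (inner x y).

Definition sq x : R := rdot x x.

Lemma rdotDl x y z : rdot (x + y) z = rdot x z + rdot y z.
Proof. by rewrite /rdot linearDl raddfD. Qed.

Lemma rdotC x y : rdot x y = rdot y x.
Proof.
have Re_conj (z : R[i]) : complex.Re (Num.conj z) = complex.Re z by case: z.
by rewrite /rdot hermC expr0 mul1r; exact: Re_conj.
Qed.

Lemma rdotDr x y z : rdot x (y + z) = rdot x y + rdot x z.
Proof. by rewrite rdotC rdotDl !(rdotC x). Qed.

Lemma rdotZl t x y : rdot (t%:C *: x) y = t * rdot x y.
Proof.
have ReM (z : R[i]) : complex.Re (t%:C * z) = t * complex.Re z.
  by case: z => a b /=; rewrite mul0r subr0.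
by rewrite /rdot linearZl_LR; exact: ReM.
Qed.

Lemma rdotZr t x y : rdot x (t%:C *: y) = t * rdot x y.
Proof. by rewrite rdotC rdotZl rdotC. Qed.

Lemma rdotNl x y : rdot (- x) y = - rdot x y.
Proof. by rewrite -scaleN1r -(rmorphN1 (real_complex R)) rdotZl mulN1r. Qed.

Lemma rdotNr x y : rdot x (- y) = - rdot x y.
Proof. by rewrite rdotC rdotNl rdotC. Qed.

Lemma rdot0l x : rdot 0 x = 0.
Proof. by rewrite -(scale0r x) -(rmorph0 (real_complex R)) rdotZl mul0r. Qed.

Lemma rdot0r x : rdot x 0 = 0.
Proof. by rewrite rdotC rdot0l. Qed.

Definition rdotE :=
  (rdotDl, rdotDr, rdotNl, rdotNr, rdotZl, rdotZr, rdot0l, rdot0r).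

Lemma normC_sq x : `|x| = (complex.Re `|x|)%:C /\ sq x = complex.Re `|x| ^+ 2.
Proof.
have xR : `|x| = (complex.Re `|x|)%:C by rewrite RRe_real// normr_real.
split=> //; rewrite /sq /rdot -normr2_inner {1}xR -rmorphXn //=.
Qed.

Lemma Re_norm_ge0 x : 0 <= complex.Re `|x|.
Proof. by have := normr_ge0 x; rewrite lecE => /andP[]. Qed.

Lemma sq_ge0 x : 0 <= sq x.
Proof. by rewrite (normC_sq x).2 sqr_ge0. Qed.

Lemma sq_eq0 x : sq x = 0 -> x = 0.
Proof.
rewrite (normC_sq x).2 => /eqP; rewrite sqrf_eq0 => /eqP x0.
by apply/eqP; rewrite -normr_eq0 (normC_sq x).1 x0.
Qed.

Lemma sq0 : sq 0 = 0. Proof. exact: rdot0l. Qed.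

Lemma sqN x : sq (- x) = sq x.
Proof. by rewrite /sq !rdotE opprK. Qed.

Lemma sqZ t x : sq (t%:C *: x) = t ^+ 2 * sq x.
Proof. by rewrite /sq !rdotE mulrA. Qed.

Lemma sqD x y : sq (x + y) = sq x + 2 * rdot x y + sq y.
Proof. by rewrite /sq !rdotE (rdotC y x); ring. Qed.

Lemma rdot_CS x y : rdot x y ^+ 2 <= sq x * sq y.
Proof.
apply: discriminant_le => [|t]; first exact: sq_ge0.
by have := sq_ge0 (x + t%:C *: y); rewrite sqD sqZ rdotZr mulrA.
Qed.

Lemma rdot_le_half x y : 2 * rdot x y <= sq x + sq y.
Proof. by have := sq_ge0 (x - y); rewrite sqD sqN rdotNr; lra. Qed.

End RealInnerProduct.

Lemma bounded_operator_sq (R : realType) (H K : hilbertType R) (T : H -> K) :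
  bounded_operator T -> exists2 M, 0 <= M & forall x, sq (T x) <= M ^+ 2 * sq x.
Proof.
case=> M TM; exists `|M| => // x.
have := TM x; rewrite (normC_sq (T x)).1 (normC_sq x).1 -rmorphM /= lecR => h.
rewrite (normC_sq (T x)).2 (normC_sq x).2 -exprMn lerXn2r ?nnegrE ?Re_norm_ge0//.
  by rewrite mulr_ge0// Re_norm_ge0.
by apply: (le_trans h); rewrite ler_wpM2r ?Re_norm_ge0// ler_norm.
Qed.

(** * Forms of symmetric operators *)

Section SymmetricForms.
Variables (R : realType) (H : hilbertType R).
Implicit Types (S : set H) (N G T : {linear H -> H}) (x y u z : H) (t r C : R).

Definition real_subspace S := forall t x y, S x -> S y -> S (x + t%:C *: y).

Definition invariant_under S (T : H -> H) := forall x, S x -> S (T x).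

Definition rsym (T : H -> H) := forall x y, rdot (T x) y = rdot x (T y).

Definition rform (T : H -> H) x : R := rdot (T x) x.

Definition form_bounded C (T : H -> H) := forall x, `|rform T x| <= C * sq x.

Lemma self_adjoint_rsym (T : H -> H) : self_adjoint T -> rsym T.
Proof. by move=> Tsa x y; rewrite /rdot Tsa. Qed.

Lemma bounded_operator_form (T : H -> H) : bounded_operator T ->
  exists2 C, 0 <= C & form_bounded C T.
Proof.
case/bounded_operator_sq => M M0 TM; exists M => // x.
rewrite -(@ler_pXn2r _ 2) ?nnegrE ?mulr_ge0 ?sq_ge0//.
rewrite real_normK ?num_real// (le_trans (rdot_CS _ _))//.
by rewrite exprMn [sq x ^+ 2]expr2 mulrA ler_wpM2r// sq_ge0.
Qed.

Lemma rformD T x y t : rsym T ->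
  rform T (x + t%:C *: y) = rform T x + 2 * t * rdot (T x) y + t ^+ 2 * rform T y.
Proof.
move=> Ts; rewrite /rform linearD linearZ_LR !rdotE (Ts y x) (rdotC y (T x)).
by ring.
Qed.

Lemma rform_add T x y : rsym T ->
  rform T (x + y) = rform T x + 2 * rdot (T x) y + rform T y.
Proof.
move=> Ts; have := rformD x y 1 Ts.
by rewrite (rmorph1 (real_complex R)) scale1r mulr1 expr1n mul1r.
Qed.

Definition shift T r : {linear H -> H} := T \- r%:C \*: idfun.

Lemma shiftE T r x : shift T r x = T x - r%:C *: x. Proof. by []. Qed.

Lemma rform_shift T r x : rform (shift T r) x = rform T x - r * sq x.
Proof. by rewrite /rform shiftE !rdotE. Qed.

Lemma rsym_shift T r : rsym T -> rsym (shift T r).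
Proof. by move=> Ts x y; rewrite !shiftE !rdotE Ts. Qed.

Lemma form_bounded_shift C T r :
  form_bounded C T -> form_bounded (C + `|r|) (shift T r).
Proof.
move=> TC x; rewrite rform_shift (le_trans (ler_normB _ _))// mulrDl lerD//.
by rewrite normrM (ger0_norm (sq_ge0 x)).
Qed.

Lemma invariant_shift S T r : real_subspace S -> invariant_under S T ->
  invariant_under S (shift T r).
Proof.
move=> Sv ST x Sx; rewrite shiftE -scaleNr -rmorphN; apply: Sv => //.
exact: ST.
Qed.

(** For a semidefinite form an isotropic vector is orthogonal to everything, by
Cauchy-Schwarz. The sign of [s] selects the sign of the form. *)
Lemma isotropic_orthogonal s S G x y : s != 0 -> real_subspace S -> rsym G ->
  (forall z, S z -> 0 <= s * rform G z) -> S x -> S y -> rform G x = 0 ->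
  rdot (G x) y = 0.
Proof.
move=> s0 Sv Gs G0 Sx Sy Gx; apply/eqP; rewrite -(mulrI_eq0 _ (mulfI s0)).
rewrite -sqrf_eq0 eq_le sqr_ge0 andbT -[leRHS](mul0r (s * rform G y)).
apply: discriminant_le => [|t]; first exact: G0.
by have := G0 _ (Sv t _ _ Sx Sy); rewrite rformD// Gx; lra.
Qed.

(** Cauchy-Schwarz for the form of [- N] applied to [x] and [N x]: a vector at
which a bounded negative form is small is almost in the kernel. *)
Lemma nsd_form_sq S N C : real_subspace S -> invariant_under S N -> rsym N ->
  0 <= C -> form_bounded C N -> (forall z, S z -> rform N z <= 0) ->
  forall x, S x -> sq (N x) <= C * - rform N x.
Proof.
move=> Sv SN Ns C0 NC N0 x Sx; have nx0 := N0 _ Sx.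
have [->|nz] := eqVneq (sq (N x)) 0; first by rewrite mulr_ge0// oppr_ge0.
have Nx : 0 < sq (N x) by rewrite lt_def nz sq_ge0.
have : sq (N x) ^+ 2 <= - rform N x * - rform N (N x).
  rewrite -sqrrN; apply: discriminant_le => [|t].
    by rewrite oppr_ge0 N0//; exact: SN.
  have : rform N (x + t%:C *: N x) <= 0 by apply/N0/Sv => //; exact: SN.
  by rewrite rformD// -[rdot (N x) (N x)]/(sq (N x)); lra.
have : - rform N (N x) <= C * sq (N x).
  by rewrite (le_trans _ (NC (N x)))// -normrN ler_norm.
move=> h1 h2; rewrite -(ler_pM2r Nx) -expr2 (le_trans h2)//.
by rewrite [leRHS]mulrAC [leRHS]mulrC ler_wpM2l// oppr_ge0.
Qed.

(** Where [N] is bounded from below in norm, its negative form stays away from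
[0] and the bound [rform N x <= 0] can be improved. *)
Lemma nsd_form_coercive S N C e : real_subspace S -> invariant_under S N ->
  rsym N -> 0 < C -> form_bounded C N -> (forall z, S z -> rform N z <= 0) ->
  (forall x, S x -> e * sq x <= sq (N x)) ->
  forall x, S x -> rform N x <= - (e / C) * sq x.
Proof.
move=> Sv SN Ns C0 NC N0 Ne x Sx.
have := le_trans (Ne x Sx) (nsd_form_sq Sv SN Ns (ltW C0) NC N0 Sx).
by rewrite mulNr lerNr mulrAC ler_pdivrMr// [- _ * C]mulrC.
Qed.

(** Along [x |-> x + h N x] the norm contracts and [G + h K C |.|^2] does not
increase; iterating, [- G - h K C |.|^2] is bounded by ever smaller multiples
of [|.|^2]. This is the discrete form of the flow [exp (t N) x], which tends
to [0] while the form of [G] decreases. *)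
Lemma decreasing_form_ge0 S N G C K d : real_subspace S -> invariant_under S N ->
  rsym N -> rsym G -> 0 < C -> 0 < K -> 0 < d ->
  form_bounded C N -> form_bounded K G ->
  (forall x, S x -> rform N x <= - d * sq x) ->
  (forall x, S x -> rdot (G x) (N x) <= 0) ->
  forall x, S x -> 0 <= rform G x.
Proof.
move=> Sv SN Ns Gs C0 K0 d0 NC GK Nd GN.
have N0 x : S x -> rform N x <= 0.
  move=> /Nd /le_trans; apply.
  by rewrite mulNr oppr_le0 mulr_ge0 ?sq_ge0// ltW.
have step h : 0 < h -> h * C <= 1 ->
    forall x, S x -> - (rform G x + h * K * C * sq x) <= 0 * sq x.
  move=> h0 hC; have hKC : 0 <= h * K * C by rewrite !mulr_ge0// ltW.
  apply: (@bound_of_improvement R H S _ (@sq R H) 0 K) => [x||x Sx|r /andP[r0 _] rb].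
  - exact: sq_ge0.
  - exact: ltW.
  - have := GK x; rewrite ler_norml => /andP[+ _].
    by have := mulr_ge0 hKC (sq_ge0 x); lra.
  exists (r * (1 - h * d)) => [|x Sx].
    by rewrite gtr_pMr// ltrBlDr ltrDl mulr_gt0.
  have ST : S (x + h%:C *: N x) by apply: Sv => //; exact: SN.
  have NN := nsd_form_sq Sv SN Ns (ltW C0) NC N0 Sx.
  have sqT : sq (x + h%:C *: N x) <= sq x + h * rform N x.
    rewrite sqD sqZ rdotZr rdotC -/(rform N x).
    have : h ^+ 2 * sq (N x) <= h * - rform N x; last by lra.
    rewrite expr2 -mulrA ler_wpM2l ?(ltW h0)//.
    rewrite (le_trans (ler_wpM2l (ltW h0) NN))// mulrA.
    by rewrite ler_piMl// oppr_ge0 N0.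
  have GT : rform G (x + h%:C *: N x) <= rform G x - h * K * C * (h * rform N x).
    rewrite rformD//.
    have h1 : 2 * h * rdot (G x) (N x) <= 0.
      by rewrite mulr_ge0_le0 ?GN// mulr_ge0// ltW.
    have h2 : h ^+ 2 * rform G (N x) <= h ^+ 2 * (K * (C * - rform N x)).
      rewrite ler_wpM2l ?sqr_ge0// (le_trans _ (ler_wpM2l (ltW K0) NN))//.
      exact: le_trans (ler_norm _) (GK _).
    by move: h1 h2; lra.
  have rx := rb _ ST.
  have rT : r * sq (x + h%:C *: N x) <= r * (1 - h * d) * sq x.
    rewrite -mulrA ler_wpM2l ?(ltW r0)// (le_trans sqT)//.
    by have := ler_wpM2l (ltW h0) (Nd _ Sx); lra.
  apply: le_trans rT; apply: le_trans rx; rewrite lerN2.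
  by have := ler_wpM2l hKC sqT; move: GT; lra.
move=> x Sx; apply/ler_addgt0Pr => e e0.
pose D := K * C * sq x + 1.
have D0 : 0 < D.
  by rewrite ltr_wpDl ?ltr01// !mulr_ge0 ?sq_ge0// ltW.
pose h := Num.min C^-1 (e / D).
have h0 : 0 < h by rewrite lt_min invr_gt0 C0 divr_gt0.
have hC : h * C <= 1.
  by rewrite -ler_pdivlMr// mul1r ge_min lexx.
have hD : h * D <= e by rewrite -ler_pdivlMr// ge_min lexx orbT.
by have := step h h0 hC x Sx; rewrite mul0r /D in hD *; move: hD; lra.
Qed.

End SymmetricForms.

(** * The spectrum bounds the form *)

Section SpectralBounds.
Variables (R : realType) (H : hilbertType R) (T : {linear H -> H}).
Hypotheses (T_bounded : bounded_operator T) (T_sa : self_adjoint T).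

Lemma not_spectrum_coercive r : ~ real_spectrum T r ->
  exists2 e, 0 < e & forall x, e * sq x <= sq (shift T r x).
Proof.
move=> /contrapT[S [/bounded_operator_sq[M M0 SM] TS _]].
have M1 : 0 < M ^+ 2 + 1 by rewrite ltr_wpDl ?sqr_ge0.
exists (M ^+ 2 + 1)^-1 => [|x]; first by rewrite invr_gt0.
rewrite mulrC ler_pdivrMr// -{1}(TS x) (le_trans (SM _))// mulrC ler_wpM2l//.
  exact: sq_ge0.
by rewrite lerDl.
Qed.

(** A bound [r] of the form of [s T] which is not in the spectrum of [s T] can
be improved, because [T - s r] has a bounded inverse. The sign [s] treats both
ends of the spectrum at once. *)
Lemma spectrum_form_bound s m : s ^+ 2 = 1 ->
  (forall t, real_spectrum T t -> s * t <= m) ->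
  forall x, s * rform T x <= m * sq x.
Proof.
move=> s2 Tm; have [C C0 TC] := bounded_operator_form T_bounded.
have Ts := self_adjoint_rsym T_sa.
have s1 : `|s| = 1.
  by apply/eqP; rewrite -(@eqrXn2 _ 2)// ?real_normK ?num_real// s2 expr1n.
move=> x; apply: (@bound_of_improvement R H setT (fun x => s * rform T x)
  (@sq R H) m (Num.max m C)) => // [y||y _|r /andP[mr _] rb].
- exact: sq_ge0.
- by rewrite le_max lexx.
- apply: (@le_trans _ _ (C * sq y)).
    by rewrite (le_trans (ler_norm _))// normrM s1 mul1r.
  by rewrite ler_wpM2r ?sq_ge0// le_max lexx orbT.
have ssr : s * (s * r) = r by rewrite mulrA -expr2 s2 mul1r.
have [|e e0 Te] := @not_spectrum_coercive (s * r).
  by move/Tm; rewrite ssr leNgt mr.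
pose N : {linear H -> H} := s%:C \*: shift T (s * r).
have NE y : N y = s%:C *: shift T (s * r) y by [].
have Nf y : rform N y = s * rform T y - r * sq y.
  by rewrite /rform NE rdotZl -/(rform _ _) rform_shift mulrBr mulrA ssr.
pose D := C + `|s * r| + 1.
have D0 : 0 < D by rewrite ltr_wpDl// addr_ge0.
have ND : form_bounded D N.
  move=> y; rewrite /rform NE rdotZl normrM s1 mul1r.
  apply: (le_trans (form_bounded_shift _ TC y)).
  by rewrite ler_wpM2r ?sq_ge0// lerDl.
exists (r - e / D) => [|y _]; first by rewrite ltrBlDr ltrDl divr_gt0.
have := @nsd_form_coercive R H setT N D e _ _ _ D0 ND _ _ y I.
have Ns : rsym N by move=> z w; rewrite !NE rdotZl rdotZr rsym_shift.
have N0 z : setT z -> rform N z <= 0.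
  by move=> _; rewrite Nf subr_le0 rb.
have Ne z : setT z -> e * sq z <= sq (N z).
  by move=> _; rewrite NE sqZ s2 mul1r.
by move=> /(_ (fun _ _ _ _ _ => I) (fun _ _ => I) Ns N0 Ne); rewrite Nf; lra.
Qed.

Lemma sup_spec_form m : (sup_spec T <= m%:E)%E ->
  forall x, rform T x <= m * sq x.
Proof.
move=> Tm x; rewrite -[rform _ _]mul1r; apply: spectrum_form_bound.
  by rewrite expr1n.
move=> t tT; rewrite mul1r -lee_fin; apply: le_trans Tm.
by apply: ereal_sup_ubound; exists t.
Qed.

Lemma inf_spec_form m : (m%:E <= inf_spec T)%E ->
  forall x, m * sq x <= rform T x.
Proof.
move=> Tm x; rewrite -lerN2 -mulNr -[- rform _ _]mulN1r; apply: spectrum_form_bound.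
  by rewrite sqrrN expr1n.
move=> t tT; rewrite mulN1r lerN2 -lee_fin; apply: (le_trans Tm).
by apply: ereal_inf_lbound; exists t.
Qed.

End SpectralBounds.

(** * Rotation of a subspace on which the form is negative *)

Section NegativeHalf.
Variables (R : realType) (H : hilbertType R) (N p : {linear H -> H}).
Variable C : R.
Hypotheses (N_sym : rsym N) (C_gt0 : 0 < C) (N_bounded : form_bounded C N).
Hypotheses (p_sym : rsym p) (p_idem : forall x, p (p x) = p x).
Hypothesis N_p : forall x, rform N (p x) <= 0.
Hypothesis N_q : forall x, 0 <= rform N (x - p x).
Implicit Types (x y u v z r : H) (S : set H).

Lemma rdot_pq x y : rdot (p x) (y - p y) = 0.
Proof. by rewrite rdotDr rdotNr -p_sym p_idem subrr. Qed.

Lemma sq_pq x : sq x = sq (p x) + sq (x - p x).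
Proof.
have -> : sq x = sq (p x + (x - p x)) by rewrite subrKC.
by rewrite [LHS]sqD rdot_pq mulr0 addr0.
Qed.

(** The operator [J - c] where [J] is [1] on the range of [p] and [-1] on its
orthogonal complement. *)
Definition reflection c : {linear H -> H} :=
  2%:C \*: p \- (1 + c)%:C \*: idfun.

Lemma reflectionE c x : reflection c x = 2%:C *: p x - (1 + c)%:C *: x.
Proof. by []. Qed.

Lemma rdot_reflection c x y : rdot (reflection c x) y =
  (1 - c) * rdot (p x) (p y) - (1 + c) * rdot (x - p x) (y - p y).
Proof.
have pq : rdot (p x) (p y) = rdot (p x) y by rewrite -p_sym p_idem.
rewrite reflectionE !rdotE -(p_sym x y) !pq; ring.
Qed.

Lemma rform_reflection c x :
  rform (reflection c) x = (1 - c) * sq (p x) - (1 + c) * sq (x - p x).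
Proof. exact: rdot_reflection. Qed.

Lemma rsym_reflection c : rsym (reflection c).
Proof.
move=> x y; rewrite [RHS]rdotC !rdot_reflection.
by rewrite (rdotC (p y)) (rdotC (y - _)).
Qed.

Lemma form_bounded_reflection c : 0 <= c <= 1 -> form_bounded 2 (reflection c).
Proof.
move=> /andP[c0 c1] x; rewrite rform_reflection (sq_pq x) ler_norml.
have := sq_ge0 (p x); have := sq_ge0 (x - p x).
by move=> h1 h2; apply/andP; split; nra.
Qed.

(** The off-diagonal part of [N] cancels when [c = 0]. *)
Lemma rdot_reflection_N c x : rdot (reflection c x) (N x) =
  (1 - c) * rform N (p x) - (1 + c) * rform N (x - p x)
  - 2 * c * rdot (p x) (N (x - p x)).
Proof.
have -> : N x = N (p x) + N (x - p x) by rewrite -linearD subrKC.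
have -> : reflection c x = (1 - c)%:C *: p x - (1 + c)%:C *: (x - p x).
  have -> : reflection c x = ((1 - c) + (1 + c))%:C *: p x - (1 + c)%:C *: x.
    by rewrite reflectionE; congr (_%:C *: _ - _); ring.
  by rewrite rmorphD scalerDl scalerBr opprB addrA.
rewrite [LHS]rdotE rdotNl !rdotZl !rdotDr /rform.
rewrite -(N_sym (x - p x) (p x)) !(rdotC (N _)).
by rewrite (rdotC (p x) (N (p x))) (rdotC (x - p x) (N (x - p x))); ring.
Qed.

Lemma rdot_reflection0_N x : rdot (reflection 0 x) (N x) <= 0.
Proof.
by have := N_p x; have := N_q x; rewrite rdot_reflection_N; lra.
Qed.

(** The subspaces on which the flow of [N] decays uniformly. *)
Definition strictly_negative_on S := exists d, [/\ 0 < d, real_subspace S,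
  invariant_under S N & forall x, S x -> rform N x <= - d * sq x].

Definition limit_of_strictly_negative u := forall e, 0 < e ->
  exists z r, [/\ u = z + r, sq r <= e &
    exists2 S, strictly_negative_on S & S z /\ forall y, S y -> rdot y r = 0].

Lemma reflection_strictly_negative S x : strictly_negative_on S -> S x ->
  0 <= rform (reflection 0) x.
Proof.
move=> [d [d0 Sv SN Nd]] Sx.
have := @decreasing_form_ge0 R H S N (reflection 0) C 2 d Sv SN N_sym
  (rsym_reflection 0) C_gt0 _ d0 N_bounded _ Nd _ x Sx.
apply => //; first by apply: form_bounded_reflection; rewrite lexx ler01.
by move=> y _; exact: rdot_reflection0_N.
Qed.

Lemma sq_reflection0 x : sq (reflection 0 x) = sq x.
Proof.
rewrite reflectionE addr0 scale1r sqD sqZ sqN rdotNr rdotZl.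
have -> : rdot (p x) x = sq (p x) by rewrite -{1}p_idem p_sym.
ring.
Qed.

Lemma reflection_limit u : limit_of_strictly_negative u ->
  0 <= rform (reflection 0) u.
Proof.
move=> ulim; apply/ler_addgt0Pr => e e0.
(* Young's inequality with weight [t] bounds the cross term by [e / 2] *)
pose t := e / 2 / (sq u + 1); have su := sq_ge0 u.
have su1 : 0 < sq u + 1 by rewrite ltr_wpDl.
have t0 : 0 < t by rewrite !divr_gt0.
have tu : t * (sq u + 1) = e / 2 by rewrite /t divfK// gt_eqF.
have [|z [r [uE re [S Sneg [Sz /(_ _ Sz) zr]]]]] :=
    ulim (Num.min (t ^+ 2) (e / 4)).
  by rewrite lt_min exprn_gt0// divr_gt0.
have Jz := reflection_strictly_negative Sneg Sz.
have rt : sq r <= t ^+ 2 by apply: le_trans re _; rewrite ge_min lexx.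
have r4 : sq r <= e / 4 by apply: le_trans re _; rewrite ge_min lexx orbT.
have zu : sq z <= sq u by rewrite uE sqD zr; have := sq_ge0 r; lra.
have Jr : - (e / 2) <= rform (reflection 0) r.
  have := form_bounded_reflection (c := 0); rewrite lexx ler01 => /(_ isT r).
  by rewrite ler_norml => /andP[+ _]; lra.
have cross : - (e / 2) <= 2 * rdot (reflection 0 z) r.
  rewrite -tu -(ler_pM2l t0).
  have := sq_ge0 (t%:C *: reflection 0 z + r).
  rewrite sqD sqZ sq_reflection0 rdotZl.
  by have := ler_wpM2l (sqr_ge0 t) zu; move: rt; lra.
have -> : rform (reflection 0) u = rform (reflection 0) z +
    2 * rdot (reflection 0 z) r + rform (reflection 0) r.
  by rewrite uE rform_add//; exact: rsym_reflection.
by move: Jz Jr cross; lra.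
Qed.

(** [N u = 0] forces [rform N z = 0] for each approximation [z] of [u], hence
[z = 0]. *)
Lemma kernel_limit0 u : limit_of_strictly_negative u -> N u = 0 -> u = 0.
Proof.
move=> ulim Nu; apply: sq_eq0; apply/eqP; rewrite eq_le sq_ge0 andbT.
apply/ler_addgt0Pr => e e0; rewrite add0r.
have [z [r [uE re [S [d [d0 _ SN Nd]] [Sz Sr]]]]] := ulim e e0.
have Nz : rform N z = 0.
  have -> : rform N z = rdot (N u) z - rdot (N z) r.
    by rewrite uE linearD rdotDl (N_sym r) (rdotC r) addrK.
  by rewrite Nu Sr ?rdot0l ?subr0//; exact: SN.
have z0 : sq z = 0.
  apply/eqP; rewrite eq_le sq_ge0 andbT -(ler_pM2l d0) mulr0.
  by have := Nd z Sz; rewrite Nz mulNr oppr_ge0.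
by rewrite uE (sq_eq0 z0) add0r.
Qed.

(** The form of [N] is semidefinite on the range of [p]; an isotropic vector of
that range is in the kernel of the compression [p N p]. *)
Lemma compression_p0 x : rform N (p x) = 0 -> p (N (p x)) = 0.
Proof.
move=> Nx; apply: sq_eq0; rewrite /sq p_sym p_idem.
apply: (@isotropic_orthogonal R H (-1) [set z | p z = z]) => //=.
- by move=> t y z /= py pz; rewrite linearD linearZ_LR/= py pz.
- by move=> z <-; rewrite mulN1r oppr_ge0.
Qed.

Lemma compression_q0 x : rform N (x - p x) = 0 ->
  p (N (x - p x)) = N (x - p x).
Proof.
move=> Nx; apply/eqP; rewrite eq_sym -subr_eq0; apply/eqP/sq_eq0.
set w := N (x - p x); have pw : p (w - p w) = 0 by rewrite linearB/= p_idem subrr.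
have -> : sq (w - p w) = rdot w (w - p w).
  by rewrite {1}/sq rdotDl rdotNl p_sym pw rdot0r subr0.
apply: (@isotropic_orthogonal R H 1 [set z | p z = 0]) => //=.
- by move=> t y z /= py pz; rewrite linearD linearZ_LR/= py pz scaler0 addr0.
- by move=> z pz; have := N_q z; rewrite pz subr0 mul1r.
- by rewrite linearB/= p_idem subrr.
Qed.

(** At a vector of the kernel the forms of the two diagonal blocks are equal,
while their signs are opposite: both vanish. So both compressions of [N] vanish
there, and [N (p x) = - N (x - p x)] lies in the range of [p] and is orthogonal
to it. *)
Lemma kernel_split x : N x = 0 -> N (p x) = 0.
Proof.
move=> Nx; have := rdot_reflection_N 0 x; rewrite Nx rdot0r => h.
have np : rform N (p x) = 0 by have := N_p x; have := N_q x; lra.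
have nq : rform N (x - p x) = 0 by have := N_p x; have := N_q x; lra.
have Nq : N (x - p x) = - N (p x) by rewrite linearB/= Nx sub0r.
have := compression_q0 nq; rewrite Nq linearN/= (compression_p0 np) oppr0.
by move/esym/eqP; rewrite oppr_eq0 => /eqP.
Qed.

Variable S : set H.
Hypotheses (S_sub : real_subspace S) (S_inv : invariant_under S N).
Hypothesis N_S : forall x, S x -> rform N x <= 0.
Hypothesis S_decomp : forall x, S x -> exists u v,
  [/\ x = u + v, p v = v, rdot u v = 0 & limit_of_strictly_negative u].

(** The two summands do not interact: [reflection 0] fixes [v], which is
orthogonal to [u]. *)
Lemma reflection_half_ge0 x : S x -> 0 <= rform (reflection 0) x.
Proof.
case/S_decomp => u [v [-> pv uv /reflection_limit]].
rewrite !rform_reflection !subr0 !addr0 !mul1r linearD pv.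
have -> : u + v - (p u + v) = u - p u by rewrite opprD addrACA subrr addr0.
by rewrite [sq (p u + v)]sqD p_sym pv uv; have := sq_ge0 v; lra.
Qed.

(** [x] is isotropic for a form that is semidefinite on [S], hence orthogonal to
[N x] for that form; the two diagonal terms that remain have opposite signs. *)
Lemma isotropic_half x : S x -> rform (reflection 0) x = 0 ->
  rform N (p x) = 0 /\ rform N (x - p x) = 0.
Proof.
move=> Sx Jx.
have := isotropic_orthogonal (oner_neq0 R) S_sub (rsym_reflection 0) _ Sx
  (S_inv Sx) Jx.
have J0 z : S z -> 0 <= 1 * rform (reflection 0) z.
  by move=> /reflection_half_ge0; rewrite mul1r.
move/(_ J0).
by rewrite rdot_reflection_N; have := N_p x; have := N_q x; split; lra.
Qed.

Section Gap.
Variables a b : R.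
Hypotheses (a_le0 : a <= 0) (b_ge0 : 0 <= b) (ab : a < b).
Hypothesis N_pa : forall x, rform N (p x) <= a * sq (p x).
Hypothesis N_qb : forall x, b * sq (x - p x) <= rform N (x - p x).

(** A bound [r] of the form of [N] on [S] with [a < r <= 0] can be improved: the
pairing of [reflection 0 x] with [N x - r x] is at most
[- (r - a) * sq (p x)], and [sq (p x)] is at least half of [sq x] on [S]. *)
Lemma half_below_gap x : S x -> rform N x <= a * sq x.
Proof.
apply: (@bound_of_improvement R H S (rform N) (@sq R H) a 0) => // [y|y Sy|].
- exact: sq_ge0.
- by rewrite mul0r N_S.
move=> r /andP[ar r0] rb.
pose D := C + `|r|; have D0 : 0 < D by rewrite ltr_wpDr.
pose e := ((r - a) / 2) ^+ 2.
have e0 : 0 < e by rewrite exprn_gt0// divr_gt0 ?subr_gt0.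
exists (r - e / D) => [|y Sy]; first by rewrite ltrBlDr ltrDl divr_gt0.
have N0 z : S z -> rform (shift N r) z <= 0.
  by move=> Sz; rewrite rform_shift subr_le0 rb.
have Ne z : S z -> e * sq z <= sq (shift N r z).
  move=> Sz; have [->|z0] := eqVneq (sq z) 0; first by rewrite mulr0 sq_ge0.
  have sz : 0 < sq z by rewrite lt_def z0 sq_ge0.
  have : (r - a) / 2 * sq z <= - rdot (reflection 0 z) (shift N r z).
    rewrite shiftE rdotDr rdotNr rdotZr -/(rform (reflection 0) z).
    rewrite rdot_reflection_N rform_reflection.
    have := reflection_half_ge0 Sz; rewrite rform_reflection (sq_pq z).
    have := N_pa z; have := N_qb z.
    have := sq_ge0 (p z); have := sq_ge0 (z - p z).
    move=> q0 p0 nq np pq.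
    have : (r - a) * sq (z - p z) <= (r - a) * sq (p z).
      by rewrite ler_wpM2l ?subr_ge0 ?(ltW ar)//; lra.
    have : r * sq (z - p z) <= 0 by rewrite mulr_le0_ge0.
    by have := mulr_ge0 b_ge0 q0; lra.
  move=> h; rewrite -(ler_pM2r sz) -mulrA -expr2 -exprMn.
  apply: (@le_trans _ _ (rdot (reflection 0 z) (shift N r z) ^+ 2)).
    rewrite -[leRHS]sqrrN ler_pXn2r ?nnegrE//; last apply: le_trans h.
      by rewrite mulr_ge0 ?divr_ge0 ?subr_ge0 ?(ltW ar) ?sq_ge0.
    by rewrite mulr_ge0 ?divr_ge0 ?subr_ge0 ?(ltW ar) ?sq_ge0.
  by rewrite (le_trans (rdot_CS _ _))// sq_reflection0 mulrC.
have := nsd_form_coercive S_sub (invariant_shift r S_sub S_inv)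
  (rsym_shift r N_sym) D0 (form_bounded_shift r N_bounded) N0 Ne Sy.
by rewrite rform_shift; lra.
Qed.

(** The condition on [c] is [c <= cos (2 theta)] for
[tan (2 theta) = 2 w / (b - a)]; it is what makes [reflection c] decrease under the flow of [N] centred in the
gap, the cross term being dominated by the diagonal ones. *)
Lemma reflection_gap_ge0 w c : 0 <= c <= 1 ->
  (forall x, rdot (p x) (N (x - p x)) ^+ 2 <= w ^+ 2 * (sq (p x) * sq (x - p x))) ->
  (c * w) ^+ 2 <= (1 - c ^+ 2) * ((b - a) / 2) ^+ 2 ->
  forall x, S x -> 0 <= rform (reflection c) x.
Proof.
move=> /andP[c0 c1] Nw cw.
pose m := (a + b) / 2; pose d := (b - a) / 2.
have d0 : 0 < d by rewrite divr_gt0// subr_gt0.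
have mC : 0 < C + `|m| by rewrite ltr_wpDr.
apply: (@decreasing_form_ge0 R H S (shift N m) (reflection c) (C + `|m|) 2 d) => //.
- exact: invariant_shift.
- exact: rsym_shift.
- exact: rsym_reflection.
- exact: form_bounded_shift.
- by apply: form_bounded_reflection; rewrite c0.
- move=> x /half_below_gap; rewrite rform_shift /m /d; lra.
move=> x _; rewrite shiftE rdotDr rdotNr rdotZr -/(rform (reflection c) x).
rewrite rdot_reflection_N rform_reflection.
have np := N_pa x; have nq := N_qb x.
have p0 := sq_ge0 (p x); have q0 := sq_ge0 (x - p x).
pose s := Num.sqrt (sq (p x)); pose t := Num.sqrt (sq (x - p x)).
have sE : s ^+ 2 = sq (p x) by rewrite sqr_sqrtr.
have tE : t ^+ 2 = sq (x - p x) by rewrite sqr_sqrtr.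
have cross : `|rdot (p x) (N (x - p x))| <= `|w| * s * t.
  rewrite -(@ler_pXn2r _ 2) ?nnegrE ?mulr_ge0 ?sqrtr_ge0//.
  by rewrite !exprMn sE tE !real_normK ?num_real// -mulrA.
have quad : 0 <= (1 - c) * d * s ^+ 2 + 2 * - (c * `|w|) * s * t +
    (1 + c) * d * t ^+ 2.
  apply: quadratic_ge0.
  - by rewrite mulr_ge0 ?subr_ge0// ltW.
  - by rewrite mulr_ge0 ?addr_ge0// ltW.
  - rewrite sqrrN exprMn real_normK ?num_real// -exprMn (le_trans cw)//.
    by rewrite /d le_eqVlt; apply/orP; left; apply/eqP; ring.
have crossc : - (c * (`|w| * s * t)) <= c * rdot (p x) (N (x - p x)).
  rewrite -mulrN ler_wpM2l//; move: cross; rewrite ler_norml => /andP[+ _] //.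
have pc : (1 - c) * rform N (p x) <= (1 - c) * (a * sq (p x)).
  by rewrite ler_wpM2l// subr_ge0.
have qc : (1 + c) * (b * sq (x - p x)) <= (1 + c) * rform N (x - p x).
  by rewrite ler_wpM2l// addr_ge0.
move: quad crossc pc qc; rewrite sE tE /d /m; lra.
Qed.

End Gap.
End NegativeHalf.

(** * Spectral subspaces of a self-adjoint operator *)

Lemma rsym_form0 (R : realType) (H : hilbertType R) (G : {linear H -> H}) :
  rsym G -> (forall x, rform G x = 0) -> forall x, G x = 0.
Proof.
move=> Gs G0 x; apply: sq_eq0.
apply: (@isotropic_orthogonal R H 1 setT) => //.
by move=> z _; rewrite G0 mulr0.
Qed.

Section SpectralSubspaces.
Variables (R : realType) (H : hilbertType R) (B : {linear H -> H}).
Variable E : set R -> {linear H -> H}.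
Hypothesis B_sym : rsym B.
Hypothesis E_B : spectral_measure B E.
Implicit Types (A D : set R) (x y u z : H) (s c l : R).

Lemma E_sym A : measurable A -> rsym (E A).
Proof. by move=> mA; exact/self_adjoint_rsym/(pvm_self_adjoint E_B.1). Qed.

Lemma E_idem A x : measurable A -> E A (E A x) = E A x.
Proof. by move=> mA; exact: (pvm_idem E_B.1). Qed.

Lemma E_setI A D x : measurable A -> measurable D ->
  E A (E D x) = E (A `&` D) x.
Proof. by move=> mA mD; rewrite (pvm_setI E_B.1). Qed.

Lemma rform_E A x : measurable A -> rform (E A) x = sq (E A x).
Proof. by move=> mA; rewrite /sq E_sym// E_idem// rdotC. Qed.

Lemma scalar_measure x : exists mu : {finite_measure set R -> \bar R},
  [/\ forall A, measurable A -> mu A = (rform (E A) x)%:E,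
      mu.-integrable setT (fun t : R => t%:E) &
      rform B x = \int[mu]_t (t : R)].
Proof.
have [mu [muA muI muB]] := E_B.2 x; exists mu; split => //.
by rewrite /rform /rdot muB.
Qed.

(** Additivity of the scalar measures gives that of their forms; the forms
determine the symmetric operators. *)
Lemma E_setU A D x : measurable A -> measurable D -> A `&` D = set0 ->
  E (A `|` D) x = E A x + E D x.
Proof.
move=> mA mD AD; have mU : measurable (A `|` D) by exact: measurableU.
pose G : {linear H -> H} := E (A `|` D) \- (E A \+ E D).
have GE y : G y = E (A `|` D) y - (E A y + E D y) by [].
have /(_ x) : forall y, G y = 0; last by rewrite GE => /eqP; rewrite subr_eq0 => /eqP.
apply: rsym_form0 => [y z|y].
  by rewrite !GE !rdotE !(E_sym mA) !(E_sym mD) !(E_sym mU).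
have [mu [muA _ _]] := scalar_measure y.
have : mu (A `|` D) = (mu A + mu D)%E by exact: measureU.
rewrite !muA// -EFinD => -[h].
by rewrite /rform GE !rdotE -!/(rform _ _) h subrr.
Qed.

Lemma E_setC A x : measurable A -> x = E A x + E (~` A) x.
Proof.
move=> mA; rewrite -E_setU ?setICr//; last exact: measurableC.
by rewrite setUv (pvm_setT E_B.1).
Qed.

Lemma E_disjoint A D x : measurable A -> measurable D -> A `&` D = set0 ->
  E A (E D x) = 0.
Proof. by move=> mA mD AD; rewrite E_setI// AD (pvm_set0 E_B.1). Qed.

(** The scalar measures of [E A x] and [E (~` A) y] add up to that of their sum,
so the cross term of the form of [B] vanishes. *)
Lemma rdot_B_setC A x y : measurable A -> rdot (B (E A x)) (E (~` A) y) = 0.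
Proof.
move=> mA; set u := E A x; set z := E (~` A) y.
have mC : measurable (~` A) by exact: measurableC.
have [mu [muA muI muB]] := scalar_measure u.
have [nu [nuA nuI nuB]] := scalar_measure z.
have [rho [rhoA rhoI rhoB]] := scalar_measure (u + z).
have rhoE D : measurable D -> rform (E D) (u + z) = rform (E D) u + rform (E D) z.
  move=> mD; rewrite rform_add; last exact: E_sym.
  have -> : rdot (E D u) z = 0; last by rewrite mulr0 addr0.
  rewrite /u /z (E_sym mD) E_setI// E_sym// !E_setI//; last exact: measurableI.
  rewrite setICA setICr setI0 (pvm_set0 E_B.1) rdot0r//.
have : rform B (u + z) = rform B u + rform B z.
  rewrite rhoB muB nuB /Rintegral.
  rewrite (eq_measure_integral (measure_add mu nu)); last first.
    move=> D mD _; apply: (etrans (rhoA D mD)); rewrite rhoE// EFinD.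
    by rewrite -(muA D mD) -(nuA D mD); exact: esym (measure_addE _ _ _).
  rewrite integral_measure_add// fineD//; exact: integrable_fin_num.
by rewrite rform_add//; lra.
Qed.

Lemma B_E_comm A x : measurable A -> B (E A x) = E A (B x).
Proof.
move=> mA; have mC : measurable (~` A) by exact: measurableC.
have E0 y : E (~` A) (B (E A y)) = 0.
  by apply: sq_eq0; rewrite /sq E_sym// E_idem// rdot_B_setC.
have E1 y : E A (B (E (~` A) y)) = 0.
  apply: sq_eq0; rewrite /sq E_sym// E_idem//.
  by rewrite -{2}[A]setCK rdot_B_setC.
rewrite {2}(E_setC x mA) linearD linearD/= E1 addr0.
by rewrite [LHS](E_setC _ mA) E0 addr0.
Qed.

(** The scalar measure of [x] is carried by [A]. *)
Lemma spectral_form_bound s c A x : measurable A ->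
  (forall t, A t -> s * t <= c) -> E A x = x -> s * rform B x <= c * sq x.
Proof.
move=> mA sA Ax; have mC : measurable (~` A) by exact: measurableC.
have [mu [muA muI ->]] := scalar_measure x.
have muAI : mu.-integrable A (EFin \o (fun t : R => t)).
  by apply: integrableS muI.
have mu0 : mu (~` A) = 0.
  rewrite muA//; congr _%:E; have := E_setC x mA.
  rewrite Ax => /eqP; rewrite -subr_eq0 opprD addrA subrr add0r oppr_eq0.
  by move=> /eqP E0; rewrite /rform E0 rdot0l.
have -> : \int[mu]_t (t : R) = \int[mu]_(t in A) t.
  by rewrite /Rintegral (negligible_integral mC)// setTD setCK.
rewrite -RintegralZl//.
have -> : c * sq x = \int[mu]_(t in A) c.
  rewrite Rintegral_cst//; congr (_ * _).
  by have /(congr1 fine) := muA A mA; rewrite /rform Ax => /esym.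
apply: le_Rintegral => //.
- exact: (integrableZl _ _ muAI).
- exact: finite_measure_integrable_cst.
Qed.

Lemma spectral_small (F : nat -> set R) x e : (forall n, measurable (F n)) ->
  {homo F : n m / (n <= m)%N >-> (m <= n)%O} -> \bigcap_n F n = set0 -> 0 < e ->
  exists n, sq (E (F n) x) <= e.
Proof.
move=> mF Fdec F0 e0; have [mu [muA _ _]] := scalar_measure x.
have := @nonincreasing_cvg_mu _ _ _ mu F _ mF _ Fdec.
rewrite F0 measure0 => /(_ _ _) h.
have /h : (mu (F 0%N) < +oo)%E by rewrite muA// ltry.
move=> /(_ measurable0) /fine_cvgP[_ /cvgrPdist_le /(_ e e0)[n _ /(_ n)]].
rewrite /= leqnn => /(_ isT); rewrite muA//= sub0r normrN rform_E// => h'.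
by exists n; apply: le_trans h'; exact: ler_norm.
Qed.

End SpectralSubspaces.

(** * The two half spaces at a point of the line *)

Section SpectralHalf.
Variables (R : realType) (H : hilbertType R) (B : {linear H -> H}).
Variable E : set R -> {linear H -> H}.
Variable C : R.
Hypotheses (B_sym : rsym B) (B_bounded : form_bounded C B).
Hypothesis E_B : spectral_measure B E.
Variable l : R.
Implicit Types (x y u v z k : H) (s c : R).

Definition side s : set R := [set t | s * t < s * l].

Definition signed_shift s : {linear H -> H} := s%:C \*: shift B l.

Lemma signed_shiftE s x : signed_shift s x = s%:C *: (B x - l%:C *: x).
Proof. by []. Qed.

Lemma signed_shift_kernel s v : shift B l v = 0 -> signed_shift s v = 0.
Proof. by move=> vl; rewrite -[LHS]/(s%:C *: shift B l v) vl scaler0. Qed.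

Lemma rsym_signed_shift s : rsym (signed_shift s).
Proof. by move=> x y; rewrite rdotZl rdotZr rsym_shift. Qed.

Lemma rform_signed_shift s x :
  rform (signed_shift s) x = s * rform B x - s * l * sq x.
Proof. by rewrite /rform rdotZl -/(rform _ _) rform_shift mulrBr mulrA. Qed.

Lemma signed_shift_bounded s :
  form_bounded (`|s| * (C + `|l|)) (signed_shift s).
Proof.
move=> x; rewrite /rform rdotZl normrM -mulrA.
by rewrite ler_wpM2l// form_bounded_shift.
Qed.

Lemma measurable_halfline s c : measurable [set t : R | s * t < c].
Proof.
have -> : [set t : R | s * t < c] = setT `&` (fun t => s * t) @^-1` `]-oo, c[.
  by rewrite setTI; apply/seteqP; split => t /=; rewrite in_itv.
exact: measurable_realfun.mulrl_measurable.
Qed.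

Lemma measurable_side s : measurable (side s).
Proof. exact: measurable_halfline. Qed.

Lemma signed_shift_E s A x : measurable A ->
  E A (signed_shift s x) = signed_shift s (E A x).
Proof.
by move=> mA; rewrite !signed_shiftE linearZ_LR linearB linearZ_LR/= (B_E_comm B_sym E_B).
Qed.

(** The strictly negative subspaces are the spectral subspaces of the half lines
at distance [1 / (n + 1)] from [l]; what remains of [side s] shrinks to the
empty set. *)
Lemma side_limit s x : E (side s) x = x ->
  limit_of_strictly_negative (signed_shift s) x.
Proof.
move=> sx e e0.
pose D n : set R := [set t | s * t < s * l - n.+1%:R^-1].
pose F n := side s `\` D n.
have mD n : measurable (D n) by exact: measurable_halfline.
have mF n : measurable (F n) by apply: measurableD => //; exact: measurable_side.
have Fdec : {homo F : n m / (n <= m)%N >-> (m <= n)%O}.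
  move=> n m nm; apply/subsetPset => t [ts Dt]; split => // Dnt; apply: Dt.
  rewrite /D /= (lt_le_trans Dnt)// lerD2l lerN2 lef_pV2 ?posrE//.
  by rewrite ler_nat ltnS.
have F0 : \bigcap_n F n = set0.
  apply/seteqP; split => // t Ft; have [ts _] := Ft 0%N I.
  have [n hn] := ltr_add_invr ts.
  by have [_] := Ft n I; apply; rewrite /D /= ltrBrDr.
have [n xe] := spectral_small E_B x mF Fdec F0 e0.
exists (E (D n) x), (E (F n) x); split => //.
  rewrite -(E_setU E_B) ?setDIK// setDUK// => t /lt_le_trans; apply.
  by rewrite gerDl oppr_le0.
exists [set z | E (D n) z = z]; first exists n.+1%:R^-1; split => //=.
- by move=> t y z /= yD zD; rewrite linearD linearZ_LR/= yD zD.
- by move=> z /= zD; rewrite signed_shift_E// zD.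
- move=> z zD; rewrite rform_signed_shift.
  have : s * rform B z <= (s * l - n.+1%:R^-1) * sq z.
    by apply: (spectral_form_bound E_B (mD n)) => // t /ltW.
  by rewrite mulrBl mulNr lerBlDr (addrC (- _)).
- exact: (E_idem E_B).
- move=> z zD; rewrite -zD (E_sym E_B)// (E_disjoint E_B) ?rdot0r//.
  by rewrite setDIK.
Qed.

Lemma real_subspace_E A : real_subspace [set z | E A z = z].
Proof. by move=> t y z /= yA zA; rewrite linearD linearZ_LR/= yA zA. Qed.

(** The form of [B] is at the same time at most and at least [l] times the
squared norm on the range of [E [set l]]. *)
Lemma E_point_kernel x : E [set l] x = x -> shift B l x = 0.
Proof.
move=> xl; have ml : measurable [set l] by exact: measurable_set1.
have B0 z : E [set l] z = z -> rform (shift B l) z = 0.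
  move=> zl; rewrite rform_shift.
  have := spectral_form_bound E_B (s := 1) (c := l) ml _ zl.
  have := spectral_form_bound E_B (s := -1) (c := - l) ml _ zl.
  have h1 t : [set l] t -> -1 * t <= - l by move=> ->; rewrite mulN1r.
  have h2 t : [set l] t -> 1 * t <= l by move=> ->; rewrite mul1r.
  by move=> /(_ h1) b1 /(_ h2) b2; lra.
apply: sq_eq0.
apply: (@isotropic_orthogonal R H 1 [set z | E [set l] z = z]) => //=.
- exact: real_subspace_E.
- exact: rsym_shift.
- by move=> z /B0 ->; rewrite mulr0.
- by rewrite linearB linearZ_LR/= -(B_E_comm B_sym E_B)// xl.
- exact: B0.
Qed.

Lemma E_side_kernel s x : shift B l x = 0 -> E (side s) x = 0.
Proof.
move=> Nx; have ms := measurable_side s.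
apply: (@kernel_limit0 R H (signed_shift s)); first exact: rsym_signed_shift.
  by apply: side_limit; exact: (E_idem E_B).
by rewrite -signed_shift_E// signed_shift_kernel// linear0.
Qed.

Lemma E_trichotomy x : x = E (side 1) x + E [set l] x + E (side (-1)) x.
Proof.
have ml : measurable [set l] by exact: measurable_set1.
have m1 := measurable_side 1; have m2 := measurable_side (-1).
rewrite {1}(E_setC E_B x m1) -addrA; congr (_ + _).
rewrite -(E_setU E_B)//.
  congr (E _ _); apply/seteqP; rewrite /side; split => t /=.
    by rewrite !mul1r !mulN1r ltrN2 => /negP; rewrite -leNgt le_eqVlt => /orP[/eqP|]; [left|right].
  rewrite !mul1r !mulN1r ltrN2 => -[->|tl]; first by rewrite ltxx.
  by apply/negP; rewrite -leNgt ltW.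
by apply/seteqP; split => // t [/= ->]; rewrite /side /= ltxx.
Qed.

Lemma kernel_E_point x : shift B l x = 0 -> E [set l] x = x.
Proof.
by move=> Nx; rewrite [RHS]E_trichotomy !E_side_kernel// add0r addr0.
Qed.

(** For [s = 1] and [s = -1] these are the two complementary spectral subspaces
compared with the ranges of [p] and of its complement. *)
Definition half_space s (p : H -> H) : set H :=
  [set x | exists u v, [/\ x = u + v, E (side s) u = u, shift B l v = 0 & p v = v]].

Variables (s : R) (p : {linear H -> H}).

Lemma half_space_subspace : real_subspace (half_space s p).
Proof.
move=> t x y [u [v [-> us vl pv]]] [u' [v' [-> us' vl' pv']]].
exists (u + t%:C *: u'), (v + t%:C *: v'); split.
- by rewrite scalerDr addrACA.
- by rewrite linearD linearZ_LR/= us us'.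
- by rewrite linearD linearZ_LR vl vl' /= scaler0 addr0.
- by rewrite linearD linearZ_LR/= pv pv'.
Qed.

Lemma half_space_invariant : invariant_under (half_space s p) (signed_shift s).
Proof.
move=> x [u [v [-> us vl pv]]].
exists (signed_shift s u), 0; split; rewrite ?linear0//.
  by rewrite linearD (signed_shift_kernel s vl).
by rewrite signed_shift_E ?us//; exact: measurable_side.
Qed.

Lemma half_space_form_le0 x : half_space s p x -> rform (signed_shift s) x <= 0.
Proof.
move=> [u [v [-> us vl pv]]]; have ss := @rsym_signed_shift s.
have sv := signed_shift_kernel s vl.
rewrite rform_add// ss sv rdot0r mulr0 addr0 {2}/rform sv rdot0l addr0.
rewrite rform_signed_shift subr_le0.
by apply: (spectral_form_bound E_B (measurable_side s)) => // t /ltW.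
Qed.

Lemma half_space_decomp x : half_space s p x -> exists u v,
  [/\ x = u + v, p v = v, rdot u v = 0 &
      limit_of_strictly_negative (signed_shift s) u].
Proof.
move=> [u [v [-> us vl pv]]]; exists u, v; split => //; last exact: side_limit.
rewrite -us (E_sym E_B); last exact: measurable_side.
by rewrite E_side_kernel// rdot0r.
Qed.

End SpectralHalf.

(** * Comparison of a half space with the range of a projection *)

Section HalfComparison.
Variables (R : realType) (H : hilbertType R) (B : {linear H -> H}).
Variables (E : set R -> {linear H -> H}) (C l s : R) (p : {linear H -> H}).
Hypotheses (B_sym : rsym B) (C_ge0 : 0 <= C) (B_bounded : form_bounded C B).
Hypothesis E_B : spectral_measure B E.
Hypotheses (p_sym : rsym p) (p_idem : forall x, p (p x) = p x).
Let N := signed_shift B l s.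
Hypothesis N_p : forall x, rform N (p x) <= 0.
Hypothesis N_q : forall x, 0 <= rform N (x - p x).
Let S := half_space B E l s p.

Let K := `|s| * (C + `|l|) + 1.

Let K_gt0 : 0 < K.
Proof. by rewrite /K ltr_wpDl// mulr_ge0// addr_ge0. Qed.

Let N_bounded : form_bounded K N.
Proof.
move=> x; rewrite mulrDl mul1r ler_wpDr ?sq_ge0//.
exact: signed_shift_bounded.
Qed.

Let N_sym : rsym N. Proof. exact: rsym_signed_shift. Qed.

Let S_decomp := @half_space_decomp R H B E B_sym E_B l s p.

Let S_sub : real_subspace S. Proof. exact: half_space_subspace. Qed.

Let S_inv : invariant_under S N. Proof. exact: half_space_invariant. Qed.

Lemma half_space_reflection_ge0 x : S x -> 0 <= rform (reflection p 0) x.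
Proof. exact: (reflection_half_ge0 N_sym K_gt0 N_bounded p_sym p_idem N_p N_q S_decomp). Qed.

Lemma half_space_le x : S x -> sq (x - p x) <= 2^-1 * sq x.
Proof.
move=> /half_space_reflection_ge0; rewrite rform_reflection// (sq_pq p_sym p_idem x).
by lra.
Qed.

Lemma half_space_isotropic x : S x -> sq (x - p x) = 2^-1 * sq x ->
  rform N (p x) = 0 /\ rform N (x - p x) = 0.
Proof.
move=> Sx h; apply: (isotropic_half N_sym K_gt0 N_bounded p_sym p_idem N_p N_q
  S_sub S_inv S_decomp Sx).
by rewrite rform_reflection//; move: h; rewrite {1}(sq_pq p_sym p_idem x); lra.
Qed.

Lemma half_space_gap a b w c : a <= 0 -> 0 <= b -> a < b ->
  (forall x, rform N (p x) <= a * sq (p x)) ->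
  (forall x, b * sq (x - p x) <= rform N (x - p x)) ->
  0 <= c <= 1 ->
  (forall x, rdot (p x) (N (x - p x)) ^+ 2 <= w ^+ 2 * (sq (p x) * sq (x - p x))) ->
  (c * w) ^+ 2 <= (1 - c ^+ 2) * ((b - a) / 2) ^+ 2 ->
  forall x, S x -> sq (x - p x) <= (1 - c) / 2 * sq x.
Proof.
move=> a0 b0 ab pa qb c01 pNq cw x Sx.
have : 0 <= rform (reflection p c) x.
  apply: (reflection_gap_ge0 N_sym K_gt0 N_bounded p_sym p_idem N_p N_q
    S_sub S_inv _ S_decomp a0 b0 ab pa qb c01 pNq cw Sx).
  by move=> y; exact: half_space_form_le0.
by rewrite rform_reflection// (sq_pq p_sym p_idem x); lra.
Qed.

End HalfComparison.

(** * Operator norms and the angle *)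

Section OperatorNorm.
Variables (R : realType) (H K : hilbertType R).
Implicit Types (T : H -> K) (m : R).

Lemma Re_norm_le_sq (x : H) (y : K) m : 0 <= m -> sq y <= m ^+ 2 * sq x ->
  complex.Re `|y| <= m * complex.Re `|x|.
Proof.
move=> m0; rewrite (normC_sq x).2 (normC_sq y).2 -exprMn.
by rewrite ler_pXn2r ?nnegrE ?mulr_ge0 ?Re_norm_ge0.
Qed.

Lemma opnorm_le_sq T m : 0 <= m -> (forall x, sq (T x) <= m ^+ 2 * sq x) ->
  opnorm T <= m.
Proof.
move=> m0 Tm; apply: ge_sup => [|_ [x x1 <-]].
  by exists (complex.Re `|T 0|), 0 => //=; rewrite normr0 ler01.
rewrite (le_trans (Re_norm_le_sq m0 (Tm x)))// ler_piMr//.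
by move: x1; rewrite /= (normC_sq x).1 -[1]/(1%:C) lecR.
Qed.

Lemma sq_le_opnorm (T : {linear H -> K}) x : bounded_operator T ->
  0 <= opnorm T /\ sq (T x) <= opnorm T ^+ 2 * sq x.
Proof.
move=> /bounded_operator_sq[M M0 TM].
pose A := [set complex.Re `|T y| | y in [set y : H | `|y| <= 1]].
have Aub : has_ubound A.
  exists M => _ [y y1 <-]; rewrite (le_trans (Re_norm_le_sq M0 (TM y)))//.
  by rewrite ler_piMr//; move: y1; rewrite /= (normC_sq y).1 -[1]/(1%:C) lecR.
have ub y : `|y| <= 1 -> complex.Re `|T y| <= opnorm T.
  by move=> y1; apply: ub_le_sup => //; exists y.
have n0 : 0 <= opnorm T.
  by apply: le_trans (ub 0 _); rewrite ?Re_norm_ge0// normr0 ler01.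
split=> //; have [->|x0] := eqVneq x 0; first by rewrite linear0 !sq0 mulr0.
set r := complex.Re `|x|.
have r0 : 0 < r.
  rewrite lt_def Re_norm_ge0 andbT; apply: contra_neq x0 => r0.
  by apply: sq_eq0; rewrite (normC_sq x).2 -/r r0 expr0n.
have sqx : sq x = r ^+ 2 by rewrite (normC_sq x).2.
have x1 : `|(r^-1)%:C *: x| <= 1.
  rewrite (normC_sq _).1 -[1]/(1%:C) lecR.
  rewrite -(@ler_pXn2r _ 2) ?nnegrE ?Re_norm_ge0// -(normC_sq _).2 sqZ sqx.
  by rewrite -exprMn mulVf ?gt_eqF.
have := ub _ x1.
rewrite -(@ler_pXn2r _ 2) ?nnegrE ?Re_norm_ge0// -(normC_sq _).2 linearZ_LR sqZ.
by rewrite exprVn mulrC ler_pdivrMr ?exprn_gt0// sqx.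
Qed.

End OperatorNorm.

Section HalfAngle.
Variable R : realType.

Lemma half_atan (t : R) : 0 <= t -> let c := cos (atan t) in
  [/\ 0 <= sin (2^-1 * atan t), sin (2^-1 * atan t) < Num.sqrt 2 / 2,
      sin (2^-1 * atan t) ^+ 2 = (1 - c) / 2, 0 <= c <= 1 &
      1 - c ^+ 2 = (t * c) ^+ 2].
Proof.
move=> t0 c; set h := 2^-1 * atan t.
have a0 : 0 <= atan t by rewrite -(atan0 R) le_atan.
have c0 : 0 < c by apply: cos_gt0_pihalf; rewrite atan_gtNpi2 atan_ltpi2.
have sE : sin h ^+ 2 = (1 - c) / 2.
  rewrite sin2cos2 /c; have -> : atan t = h *+ 2.
    by rewrite /h -mulr_natl mulrA mulfV ?pnatr_eq0// mul1r.
  by rewrite cos_mulr2n -mulr_natl; lra.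
have h0 : 0 <= sin h.
  apply: sin_ge0_pi; rewrite /h mulr_ge0 ?invr_ge0//=.
  have := atan_ltpi2 t; have := pi_gt0 R; lra.
have r0 : 0 < Num.sqrt 2 :> R by rewrite sqrtr_gt0.
split=> //.
- rewrite -(@ltr_pXn2r _ 2) ?nnegrE ?divr_ge0 ?(ltW r0)//.
  by rewrite sE expr_div_n sqr_sqrtr//; lra.
- by rewrite (ltW c0) cos_le1.
- rewrite exprMn -[in RHS](atanK t) /tan expr_div_n mulfVK ?sin2cos2//.
  by rewrite expf_neq0// gt_eqF.
Qed.

End HalfAngle.

(** * Block operators *)

Section BlockOperator.
Variables (R : realType) (H H0 H1 : hilbertType R).
Variables (j0 : {linear H0 -> H}) (j1 : {linear H1 -> H}).
Hypothesis H_decomp : orthogonal_decomposition j0 j1.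
Variables (A0 : {linear H0 -> H0}) (A1 : {linear H1 -> H1}).
Variables (V : {linear H1 -> H0}) (Vstar : {linear H0 -> H1}).
Hypotheses (A0_bounded : bounded_operator A0) (A0_sa : self_adjoint A0).
Hypotheses (A1_bounded : bounded_operator A1) (A1_sa : self_adjoint A1).
Hypothesis V_bounded : bounded_operator V.
Hypothesis Vstar_adjoint : is_adjoint V Vstar.
Variable B : {linear H -> H}.
Hypothesis B_block : block_operator j0 j1 A0 V Vstar A1 B.
Variable P : {linear H -> H}.
Hypothesis P_proj : projection_onto (range j0) P.
Implicit Types (a : H0) (b : H1) (x y : H).

Lemma rdot_j0 a a' : rdot (j0 a) (j0 a') = rdot a a'.
Proof. by rewrite /rdot (decomp_isometry0 H_decomp). Qed.

Lemma rdot_j1 b b' : rdot (j1 b) (j1 b') = rdot b b'.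
Proof. by rewrite /rdot (decomp_isometry1 H_decomp). Qed.

Lemma rdot_j01 a b : rdot (j0 a) (j1 b) = 0.
Proof. by rewrite /rdot (decomp_orthogonal H_decomp). Qed.

Lemma rdot_j10 a b : rdot (j1 b) (j0 a) = 0.
Proof. by rewrite rdotC rdot_j01. Qed.

Definition rdot_blockE := (rdot_j0, rdot_j1, rdot_j01, rdot_j10).

Lemma P_block a b : P (j0 a + j1 b) = j0 a.
Proof.
have [[a' _ Pa] Porth] := P_proj (j0 a + j1 b).
have : rdot (j0 a + j1 b - j0 a') (j0 (a - a')) = 0.
  by rewrite /rdot Pa Porth//; exists (a - a').
rewrite addrAC -linearB rdotDl rdot_j10 addr0 rdot_j0 => /sq_eq0/eqP.
by rewrite subr_eq0 -Pa => /eqP ->.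
Qed.

Lemma Q_block a b : j0 a + j1 b - P (j0 a + j1 b) = j1 b.
Proof. by rewrite P_block addrAC subrr add0r. Qed.

Lemma P_sym : rsym P.
Proof.
move=> x y; have [a [b ->]] := decomp_total H_decomp x.
have [a' [b' ->]] := decomp_total H_decomp y.
by rewrite !P_block !rdotE !rdot_blockE.
Qed.

Lemma P_idem x : P (P x) = P x.
Proof.
have [a [b ->]] := decomp_total H_decomp x; rewrite P_block.
by have := P_block a 0; rewrite linear0 addr0.
Qed.

Lemma B_j0 a : B (j0 a) = j0 (A0 a) + j1 (Vstar a).
Proof. by have := B_block a 0; rewrite !linear0 !addr0. Qed.

Lemma B_j1 b : B (j1 b) = j0 (V b) + j1 (A1 b).
Proof. by have := B_block 0 b; rewrite !linear0 !add0r. Qed.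

Lemma Vstar_rdot a b : rdot (V b) a = rdot b (Vstar a).
Proof. by rewrite /rdot Vstar_adjoint. Qed.

Lemma B_rsym : rsym B.
Proof.
move=> x y; have [a [b ->]] := decomp_total H_decomp x.
have [a' [b' ->]] := decomp_total H_decomp y.
rewrite !linearD !B_j0 !B_j1 !rdotE !rdot_blockE !Vstar_rdot.
rewrite (self_adjoint_rsym A0_sa) (self_adjoint_rsym A1_sa).
rewrite (rdotC (Vstar a)) -!Vstar_rdot (rdotC a (V b')); ring.
Qed.

Lemma rform_B_j0 a : rform B (j0 a) = rform A0 a.
Proof. by rewrite /rform B_j0 rdotDl !rdot_blockE addr0. Qed.

Lemma rform_B_j1 b : rform B (j1 b) = rform A1 b.
Proof. by rewrite /rform B_j1 rdotDl !rdot_blockE add0r. Qed.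

Lemma sq_j0 a : sq (j0 a) = sq a. Proof. exact: rdot_j0. Qed.

Lemma sq_j1 b : sq (j1 b) = sq b. Proof. exact: rdot_j1. Qed.

Lemma B_form_bounded : exists2 C, 0 <= C & form_bounded C B.
Proof.
have [C0 C0p A0C] := bounded_operator_form A0_bounded.
have [C1 C1p A1C] := bounded_operator_form A1_bounded.
have [M M0 VM] := bounded_operator_sq V_bounded.
exists (C0 + C1 + M ^+ 2 + 1) => [|x]; first by rewrite !addr_ge0// sqr_ge0.
have [a [b ->]] := decomp_total H_decomp x.
rewrite rform_add; last exact: B_rsym.
rewrite rform_B_j0 rform_B_j1 sqD rdot_j01 mulr0 addr0 sq_j0 sq_j1.
have -> : rdot (B (j0 a)) (j1 b) = rdot (V b) a.
  by rewrite B_j0 rdotDl !rdot_blockE add0r rdotC Vstar_rdot.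
have := A0C a; have := A1C b; have := VM b.
have := rdot_le_half (V b) a; have := rdot_le_half (- V b) a.
rewrite rdotNl sqN !ler_norml.
move=> h1 h2 h3 /andP[h4 h5] /andP[h6 h7].
have k1 := mulr_ge0 C0p (sq_ge0 b); have k2 := mulr_ge0 C1p (sq_ge0 a).
have k3 := mulr_ge0 (sqr_ge0 M) (sq_ge0 a).
have k4 := sq_ge0 a; have k5 := sq_ge0 b.
by apply/andP; split; lra.
Qed.

Definition compl_proj : {linear H -> H} := idfun \- P.

Lemma compl_projE x : compl_proj x = x - P x. Proof. by []. Qed.

Lemma compl_projK x : x - compl_proj x = P x.
Proof. by rewrite compl_projE opprB addrC subrK. Qed.

Lemma compl_proj_sym : rsym compl_proj.
Proof. by move=> x y; rewrite !compl_projE !rdotE P_sym. Qed.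

Lemma compl_proj_idem x : compl_proj (compl_proj x) = compl_proj x.
Proof. by rewrite !compl_projE linearB/= P_idem subrr subr0. Qed.

Variable l : R.

Lemma signed_form_j0 s a :
  rform (signed_shift B l s) (j0 a) = s * (rform A0 a - l * sq a).
Proof. by rewrite rform_signed_shift rform_B_j0 sq_j0 mulrBr mulrA. Qed.

Lemma signed_form_j1 s b :
  rform (signed_shift B l s) (j1 b) = s * (rform A1 b - l * sq b).
Proof. by rewrite rform_signed_shift rform_B_j1 sq_j1 mulrBr mulrA. Qed.

Section BelowAbove.
Variables a b : R.
Hypothesis A0_le : forall x : H0, rform A0 x <= a * sq x.
Hypothesis A1_ge : forall x : H1, b * sq x <= rform A1 x.

Lemma block_form_p1 x :
  rform (signed_shift B l 1) (P x) <= (a - l) * sq (P x).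
Proof.
have [u [v ->]] := decomp_total H_decomp x.
by rewrite P_block signed_form_j0 sq_j0 mul1r mulrBl lerD2r.
Qed.

Lemma block_form_q1 x :
  (b - l) * sq (x - P x) <= rform (signed_shift B l 1) (x - P x).
Proof.
have [u [v ->]] := decomp_total H_decomp x.
by rewrite Q_block signed_form_j1 sq_j1 mul1r mulrBl lerD2r.
Qed.

Lemma block_form_pN1 x : rform (signed_shift B l (-1)) (compl_proj x) <=
  (l - b) * sq (compl_proj x).
Proof.
have [u [v ->]] := decomp_total H_decomp x.
by rewrite compl_projE Q_block signed_form_j1 sq_j1 mulN1r opprB mulrBl lerD2l lerN2.
Qed.

Lemma block_form_qN1 x : (l - a) * sq (x - compl_proj x) <=
  rform (signed_shift B l (-1)) (x - compl_proj x).
Proof.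
have [u [v ->]] := decomp_total H_decomp x.
by rewrite compl_projK P_block signed_form_j0 sq_j0 mulN1r opprB mulrBl lerD2l lerN2.
Qed.

End BelowAbove.

Section OffDiagonal.
Variable w : R.
Hypothesis Vw : forall b, sq (V b) <= w ^+ 2 * sq b.

Lemma block_cross1 x : rdot (P x) (signed_shift B l 1 (x - P x)) ^+ 2 <=
  w ^+ 2 * (sq (P x) * sq (x - P x)).
Proof.
have [u [v ->]] := decomp_total H_decomp x.
rewrite Q_block P_block signed_shiftE scale1r B_j1 !rdotE !rdot_blockE.
rewrite addr0 mulr0 subr0 sq_j0 sq_j1 (le_trans (rdot_CS _ _))//.
by rewrite mulrCA ler_wpM2l ?sq_ge0.
Qed.

Lemma block_crossN1 x :
  rdot (compl_proj x) (signed_shift B l (-1) (x - compl_proj x)) ^+ 2 <=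
  w ^+ 2 * (sq (compl_proj x) * sq (x - compl_proj x)).
Proof.
have [u [v ->]] := decomp_total H_decomp x.
rewrite compl_projK compl_projE Q_block P_block signed_shiftE B_j0.
rewrite rdotZr mulN1r sqrrN !rdotE !rdot_blockE.
rewrite add0r mulr0 subr0 sq_j0 sq_j1 -Vstar_rdot (le_trans (rdot_CS _ _))//.
by rewrite mulrA ler_wpM2r ?sq_ge0.
Qed.

End OffDiagonal.

Hypothesis A0_le : forall x : H0, rform A0 x <= l * sq x.
Hypothesis A1_ge : forall x : H1, l * sq x <= rform A1 x.

Lemma block_form_p1_le0 x : rform (signed_shift B l 1) (P x) <= 0.
Proof. by have := block_form_p1 A0_le x; rewrite subrr mul0r. Qed.

Lemma block_form_q1_ge0 x : 0 <= rform (signed_shift B l 1) (x - P x).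
Proof. by have := block_form_q1 A1_ge x; rewrite subrr mul0r. Qed.

Lemma block_form_pN1_le0 x : rform (signed_shift B l (-1)) (compl_proj x) <= 0.
Proof. by have := block_form_pN1 A1_ge x; rewrite subrr mul0r. Qed.

Lemma block_form_qN1_ge0 x :
  0 <= rform (signed_shift B l (-1)) (x - compl_proj x).
Proof. by have := block_form_qN1 A0_le x; rewrite subrr mul0r. Qed.

Lemma rform_A0_eq0 a : rform A0 a - l * sq a = 0 -> A0 a - l%:C *: a = 0.
Proof.
rewrite -rform_shift => a0; apply: sq_eq0.
apply: (@isotropic_orthogonal R H0 (-1) setT (shift A0 l)) => //.
- exact/rsym_shift/self_adjoint_rsym.
- by move=> z _; rewrite rform_shift mulN1r oppr_ge0 subr_le0.
Qed.

Lemma rform_A1_eq0 b : rform A1 b - l * sq b = 0 -> A1 b - l%:C *: b = 0.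
Proof.
rewrite -rform_shift => b0; apply: sq_eq0.
apply: (@isotropic_orthogonal R H1 1 setT (shift A1 l)) => //.
- exact/rsym_shift/self_adjoint_rsym.
- by move=> z _; rewrite rform_shift mul1r subr_ge0.
Qed.

(** Equality of the two norms makes the triviality of a single kernel enough. *)
Lemma isotropic_eq0 s x : s != 0 ->
  Ker (fun a => A0 a - l%:C *: a) = [set 0] \/
  Ker (fun b => A1 b - l%:C *: b) = [set 0] ->
  rform (signed_shift B l s) (P x) = 0 ->
  rform (signed_shift B l s) (x - P x) = 0 ->
  sq (P x) = sq (x - P x) -> x = 0.
Proof.
move=> s0 ker; have [a [b ->]] := decomp_total H_decomp x.
rewrite Q_block P_block signed_form_j0 signed_form_j1 sq_j0 sq_j1.
move=> /eqP; rewrite mulf_eq0 (negbTE s0) /= => /eqP /rform_A0_eq0 ka.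
move=> /eqP; rewrite mulf_eq0 (negbTE s0) /= => /eqP /rform_A1_eq0 kb ab.
case: ker => ker.
  have : Ker (fun a => A0 a - l%:C *: a) a by [].
  rewrite ker => /= a0; rewrite a0 sq0 in ab.
  by rewrite a0 (sq_eq0 (esym ab)) !linear0 addr0.
have : Ker (fun b => A1 b - l%:C *: b) b by [].
rewrite ker => /= b0; rewrite b0 sq0 in ab.
by rewrite b0 (sq_eq0 ab) !linear0 addr0.
Qed.

Variable E : set R -> {linear H -> H}.
Hypothesis E_B : spectral_measure B E.
Variable Q : {linear H -> H}.
Hypothesis Q_proj : projection_onto (frakQ j0 E l) Q.

Lemma Q_half_space x : half_space B E l 1 P (Q x).
Proof.
have [[u [u' _ uE] [v [[v' _ vE] [a _ va]] <-]] _] := Q_proj x.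
exists u, v; split => //.
- have -> : side l 1 = `]-oo, l[%classic.
    by apply/seteqP; split => t; rewrite /side /= in_itv /= !mul1r.
  by rewrite -uE (E_idem E_B).
- by apply: (E_point_kernel B_rsym E_B); rewrite -vE (E_idem E_B).
- by rewrite -va; have := P_block a 0; rewrite linear0 addr0.
Qed.

Lemma Q_orth x y : frakQ j0 E l y -> rdot (x - Q x) y = 0.
Proof. by move=> Qy; rewrite /rdot (Q_proj x).2. Qed.

(** A vector orthogonal to [frakQ] has no component below [l]; its component in
the kernel splits along [H0] and [H1], and the [H0] part lies in [frakQ]. *)
Lemma QC_half_space x : half_space B E l (-1) compl_proj (x - Q x).
Proof.
set w := x - Q x.
have ml : measurable [set l] by exact: measurable_set1.
have [C C0 BC] := B_form_bounded.
have w1 : E (side l 1) w = 0.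
  apply: sq_eq0; rewrite -(rform_E E_B) ?/rform; last exact: measurable_side.
  rewrite rdotC; apply: Q_orth; exists (E (side l 1) w).
    have -> : side l 1 = `]-oo, l[%classic; last by exists w.
    by apply/seteqP; split => t; rewrite /side /= in_itv /= !mul1r.
  exists 0; rewrite ?addr0//; split; first by exists 0; rewrite ?linear0.
  by exists 0; rewrite ?linear0.
pose k := E [set l] w.
have kl : shift B l k = 0 by apply: (E_point_kernel B_rsym E_B); rewrite (E_idem E_B).
have Pkl : shift B l (P k) = 0.
  have := kernel_split (rsym_signed_shift B_rsym l 1) P_sym P_idem
    block_form_p1_le0 block_form_q1_ge0 (signed_shift_kernel 1 kl).
  by rewrite -[LHS]/(1%:C *: shift B l (P k)) scale1r.
have EPk := kernel_E_point B_rsym E_B Pkl.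
have Pk0 : P k = 0.
  apply: sq_eq0; have -> : sq (P k) = rdot w (P k).
    by rewrite -[in RHS]EPk -(E_sym E_B ml) -/k /sq P_sym P_idem.
  apply: Q_orth; exists 0; first by exists 0; rewrite ?linear0.
  exists (P k); rewrite ?add0r//; split; first by exists (P k).
  exact: (P_proj k).1.
exists (E (side l (-1)) w), k; split => //.
- by rewrite {1}(E_trichotomy E_B l w) w1 add0r addrC.
- by rewrite (E_idem E_B)//; exact: measurable_side.
- by rewrite compl_projE Pk0 subr0.
Qed.

Lemma sq_projections_sub x : sq ((P \- Q) x) =
  sq (P (x - Q x)) + sq (Q x - P (Q x)).
Proof.
have -> : (P \- Q) x = P (x - Q x) - (Q x - P (Q x)).
  by rewrite linearB/= opprB addrA subrK.
by rewrite [LHS]sqD sqN rdotNr (rdot_pq P_sym P_idem) oppr0 mulr0 addr0.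
Qed.

Lemma sq_Q_split x : sq x = sq (Q x) + sq (x - Q x).
Proof.
have -> : sq x = sq ((x - Q x) + Q x) by rewrite subrK.
rewrite [LHS]sqD Q_orth ?mulr0 ?addr0; first by rewrite addrC.
exact: (Q_proj x).1.
Qed.

Lemma sq_projections_sub_le m :
  (forall y, half_space B E l 1 P y -> sq (y - P y) <= m * sq y) ->
  (forall y, half_space B E l (-1) compl_proj y -> sq (P y) <= m * sq y) ->
  forall x, sq ((P \- Q) x) <= m * sq x.
Proof.
move=> h1 h2 x; rewrite sq_projections_sub (sq_Q_split x) mulrDr addrC.
by rewrite lerD ?h1 ?h2//; [exact: Q_half_space|exact: QC_half_space].
Qed.

Lemma Q_half_le y : half_space B E l 1 P y -> sq (y - P y) <= 2^-1 * sq y.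
Proof.
have [C C0 BC] := B_form_bounded.
exact: (half_space_le B_rsym C0 BC E_B P_sym P_idem block_form_p1_le0
  block_form_q1_ge0).
Qed.

Lemma QC_half_le y : half_space B E l (-1) compl_proj y ->
  sq (P y) <= 2^-1 * sq y.
Proof.
have [C C0 BC] := B_form_bounded; rewrite -compl_projK.
exact: (half_space_le B_rsym C0 BC E_B compl_proj_sym compl_proj_idem
  block_form_pN1_le0 block_form_qN1_ge0).
Qed.

Lemma opnorm_projections_sub_le : opnorm (P \- Q) <= Num.sqrt 2 / 2.
Proof.
apply: opnorm_le_sq; first by rewrite divr_ge0// sqrtr_ge0.
have -> : (Num.sqrt 2 / 2 : R) ^+ 2 = 2^-1.
  by rewrite expr_div_n sqr_sqrtr//; field.
by apply: sq_projections_sub_le; [exact: Q_half_le|exact: QC_half_le].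
Qed.

Lemma projections_sub_maximal_eq0 x :
  Ker (fun a => A0 a - l%:C *: a) = [set 0] \/
  Ker (fun b => A1 b - l%:C *: b) = [set 0] ->
  sq ((P \- Q) x) = 2^-1 * sq x -> x = 0.
Proof.
move=> ker; have [C C0 BC] := B_form_bounded.
have hy := Q_half_space x; have hw := QC_half_space x.
set y := Q x in hy; set w := x - Q x in hw.
rewrite sq_projections_sub (sq_Q_split x) -/y -/w.
have ly := Q_half_le hy; have lw := QC_half_le hw => e.
have ey : sq (y - P y) = 2^-1 * sq y by lra.
have ew : sq (P w) = 2^-1 * sq w by lra.
have y0 : y = 0.
  have [n1 n2] := half_space_isotropic B_rsym C0 BC E_B P_sym P_idem
    block_form_p1_le0 block_form_q1_ge0 hy ey.
  apply: (isotropic_eq0 (oner_neq0 R) ker n1 n2).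
  by move: ey; rewrite (sq_pq P_sym P_idem y); lra.
have w0 : w = 0.
  rewrite -compl_projK in ew.
  have [n1 n2] := half_space_isotropic B_rsym C0 BC E_B compl_proj_sym
    compl_proj_idem block_form_pN1_le0 block_form_qN1_ge0 hw ew.
  rewrite compl_projK in n2 ew.
  apply: (isotropic_eq0 _ ker n2 n1); first by rewrite oppr_eq0 oner_neq0.
  by move: ew; rewrite (sq_pq P_sym P_idem w); lra.
by rewrite -(subrK (Q x) x) -/w w0 -/y y0 addr0.
Qed.

Lemma projections_sub_eigenvalue t : t ^+ 2 = 2^-1 ->
  Ker (fun a => A0 a - l%:C *: a) = [set 0] \/
  Ker (fun b => A1 b - l%:C *: b) = [set 0] ->
  ~ is_eigenvalue (P \- Q) t%:C.
Proof.
move=> t2 ker [x /eqP x0 Dx]; apply: x0; apply: projections_sub_maximal_eq0 => //.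
by rewrite Dx sqZ t2.
Qed.

Lemma opnorm_projections_sub_gap (a b w e : R) : a <= l <= b -> 0 < e <= b - a ->
  (forall x : H0, rform A0 x <= a * sq x) -> (forall x : H1, b * sq x <= rform A1 x) ->
  0 <= w -> (forall x : H1, sq (V x) <= w ^+ 2 * sq x) ->
  opnorm (P \- Q) <= sin (2^-1 * atan (2 * w / e)).
Proof.
move=> /andP[al lb] /andP[e0 eab] A0a A1b w0 Vw.
have [C C0 BC] := B_form_bounded.
have t0 : 0 <= 2 * w / e by rewrite divr_ge0 ?mulr_ge0// ltW.
have [s0 _ sE c01 cE] := half_atan t0.
set c := cos _ in sE c01 cE.
have c0 : 0 <= c by case/andP: c01.
have ab : a < b by lra.
have cw : (c * w) ^+ 2 <= (1 - c ^+ 2) * ((b - a) / 2) ^+ 2.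
  have ba : 0 <= 2 * w / e * c * ((b - a) / 2).
    by rewrite mulr_ge0 ?divr_ge0 ?subr_ge0 ?(ltW ab)// mulr_ge0.
  rewrite cE -exprMn ler_pXn2r ?nnegrE ?(mulr_ge0 c0 w0)//.
  have -> : c * w = 2 * w / e * c * (e / 2) by field; rewrite gt_eqF.
  by rewrite ler_wpM2l ?ler_pM2r ?invr_gt0// mulr_ge0.
apply: opnorm_le_sq => //; rewrite sE; apply: sq_projections_sub_le => y.
- apply: (half_space_gap B_rsym C0 BC E_B P_sym P_idem block_form_p1_le0
    block_form_q1_ge0 (a := a - l) (b := b - l) _ _ _ (block_form_p1 A0a)
    (block_form_q1 A1b) c01 (block_cross1 Vw)); rewrite ?subr_le0 ?subr_ge0//.
  + by rewrite ltrD2r.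
  + by have -> : b - l - (a - l) = b - a by ring.
- rewrite -compl_projK.
  apply: (half_space_gap B_rsym C0 BC E_B compl_proj_sym compl_proj_idem
    block_form_pN1_le0 block_form_qN1_ge0 (a := l - b) (b := l - a) _ _ _
    (block_form_pN1 A1b) (block_form_qN1 A0a) c01 (block_crossN1 Vw));
    rewrite ?subr_le0 ?subr_ge0//.
  + by rewrite ltrD2l ltrN2.
  + by have -> : l - a - (l - b) = b - a by ring.
Qed.

(** On each half space the vanishing component dominates the other one, or the
bound concerns the vanishing component itself. *)
Lemma opnorm_projections_sub_degenerate :
  (forall a, a = 0) \/ (forall b, b = 0) -> opnorm (P \- Q) <= 0.
Proof.
move=> H01; apply: opnorm_le_sq => // x; rewrite expr0n.
apply: sq_projections_sub_le x => y hy; rewrite mul0r.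
- have := Q_half_le hy; rewrite (sq_pq P_sym P_idem y).
  have [a [b ->]] := decomp_total H_decomp y; rewrite Q_block P_block.
  case: H01 => h; first by rewrite (h a) linear0 sq0; lra.
  by rewrite (h b) linear0 sq0.
- have := QC_half_le hy; rewrite (sq_pq P_sym P_idem y).
  have [a [b ->]] := decomp_total H_decomp y; rewrite Q_block P_block.
  case: H01 => h; first by rewrite (h a) linear0 sq0.
  by rewrite (h b) linear0 sq0; lra.
Qed.

End BlockOperator.

Section EmptySpectrum.
Variables (R : realType) (H : hilbertType R) (T : {linear H -> H}).
Hypotheses (T_bounded : bounded_operator T) (T_sa : self_adjoint T).

(** With empty spectrum every real number is an upper bound of the form. *)
Lemma empty_spectrum_eq0 : real_spectrum T = set0 -> forall x : H, x = 0.
Proof.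
move=> T0 x; have [C C0 TC] := bounded_operator_form T_bounded.
have Tx : 1 * rform T x <= - (C + 1) * sq x.
  by apply: spectrum_form_bound => //; [rewrite expr1n|move=> t; rewrite T0].
apply: sq_eq0; have := TC x; rewrite ler_norml => /andP[+ _].
by have := sq_ge0 x; move: Tx; lra.
Qed.

End EmptySpectrum.

(* In the degenerate case where H0 or H1 is the zero space, d is +oo and the
   quotient by [fine d] is 0, in accordance with 2 ||V|| / +oo = 0. *)
Theorem theorem2p7 (R : realType) (H H0 H1 : hilbertType R)
  (H_separable : separable H)
  (j0 : {linear H0 -> H}) (j1 : {linear H1 -> H})
  (H_decomp : orthogonal_decomposition j0 j1)
  (A0 : {linear H0 -> H0}) (A1 : {linear H1 -> H1}) (V : {linear H1 -> H0})
  (A0_bounded : bounded_operator A0) (A0_sa : self_adjoint A0)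
  (A1_bounded : bounded_operator A1) (A1_sa : self_adjoint A1)
  (V_bounded : bounded_operator V)
  (lambda : R)
  (A0_lambda : (sup_spec A0 <= lambda%:E)%E)
  (lambda_A1 : (lambda%:E <= inf_spec A1)%E)
  (Vstar : {linear H0 -> H1}) (Vstar_adjoint : is_adjoint V Vstar)
  (B : {linear H -> H}) (B_block : block_operator j0 j1 A0 V Vstar A1 B)
  (E_B : set R -> {linear H -> H}) (E_B_spectral : spectral_measure B E_B)
  (P Q : {linear H -> H})
  (P_proj : projection_onto (range j0) P)
  (Q_proj : projection_onto (frakQ j0 E_B lambda) Q) :
  [/\ opnorm (P \- Q) <= Num.sqrt 2 / 2,
      (Ker (fun x => A0 x - lambda%:C *: x) = [set 0] \/
       Ker (fun x => A1 x - lambda%:C *: x) = [set 0]) ->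
        ~ is_eigenvalue (P \- Q) (Num.sqrt 2 / 2)%:C /\
        ~ is_eigenvalue (P \- Q) (- (Num.sqrt 2 / 2))%:C &
      let d := spec_dist A0 A1 in
      (0 < d)%E ->
        opnorm (P \- Q) <= sin (2^-1 * atan (2 * opnorm V / fine d))
        /\ sin (2^-1 * atan (2 * opnorm V / fine d)) < Num.sqrt 2 / 2].
Proof.
have A0_le := sup_spec_form A0_bounded A0_sa A0_lambda.
have A1_ge := inf_spec_form A1_bounded A1_sa lambda_A1.
split.
- exact: (opnorm_projections_sub_le H_decomp A0_bounded A0_sa A1_bounded A1_sa
    V_bounded Vstar_adjoint B_block P_proj A0_le A1_ge E_B_spectral Q_proj).
- have h2 : (Num.sqrt 2 / 2 : R) ^+ 2 = 2^-1.
    by rewrite expr_div_n sqr_sqrtr//; field.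
  move=> ker; split; apply: (projections_sub_eigenvalue H_decomp A0_bounded A0_sa
    A1_bounded A1_sa V_bounded Vstar_adjoint B_block P_proj A0_le A1_ge
    E_B_spectral Q_proj) => //; by rewrite sqrrN.
move=> d d0.
have w0 : 0 <= opnorm V by have [] := sq_le_opnorm 0 V_bounded.
have Vw x : sq (V x) <= opnorm V ^+ 2 * sq x.
  by have [] := sq_le_opnorm x V_bounded.
have fd0 : 0 <= fine d by apply: fine_ge0; exact: ltW.
have t0 : 0 <= 2 * opnorm V / fine d by rewrite divr_ge0 ?mulr_ge0.
have [sin0 sin1 _ _ _] := half_atan t0; split => //.
have A0l s : real_spectrum A0 s -> s <= lambda.
  move=> As; rewrite -lee_fin (le_trans _ A0_lambda)//.
  by apply: ereal_sup_ubound; exists s.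
have A1l t : real_spectrum A1 t -> lambda <= t.
  move=> At; rewrite -lee_fin (le_trans lambda_A1)//.
  by apply: ereal_inf_lbound; exists t.
have degenerate := opnorm_projections_sub_degenerate H_decomp A0_bounded A0_sa
  A1_bounded A1_sa V_bounded Vstar_adjoint B_block P_proj A0_le A1_ge
  E_B_spectral Q_proj.
(* if a spectrum is empty, then its space is zero and so is [P - Q] *)
have [A00|/set0P[s As]] := eqVneq (real_spectrum A0) set0.
  by apply: le_trans sin0; apply: degenerate; left;
    exact: (empty_spectrum_eq0 A0_bounded A0_sa A00).
have [A10|/set0P[t At]] := eqVneq (real_spectrum A1) set0.
  by apply: le_trans sin0; apply: degenerate; right;
    exact: (empty_spectrum_eq0 A1_bounded A1_sa A10).
have d_le u v : real_spectrum A0 u -> real_spectrum A1 v -> (d <= (v - u)%:E)%E.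
  move=> Au Av; have uv : u <= v by rewrite (le_trans (A0l u Au))// A1l.
  rewrite -[v - u]ger0_norm ?subr_ge0// distrC.
  by apply: ereal_inf_lbound; exists u => //; exists v.
have dfin : d = (fine d)%:E.
  rewrite fineK//; apply: fin_real; rewrite (lt_trans (ltNyr 0) d0) /=.
  by rewrite (le_lt_trans (d_le _ _ As At))// ltry.
have e0 : 0 < fine d by rewrite -lte_fin -dfin.
(* the maximum keeps [lambda] between [a] and [b] *)
pose a := sup (real_spectrum A0); pose b := Num.max (a + fine d) lambda.
have Aub : ubound (real_spectrum A0) lambda by move=> u /A0l.
have al : a <= lambda by apply: ge_sup => //; exists s.
apply: (opnorm_projections_sub_gap H_decomp A0_bounded A0_sa A1_bounded A1_sa
  V_bounded Vstar_adjoint B_block P_proj A0_le A1_ge E_B_spectral Q_proj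
  (a := a) (b := b)) => //.
- by rewrite al le_max lexx orbT.
- by rewrite e0 lerBrDl le_max lexx.
- move=> x; rewrite -[rform _ _]mul1r.
  apply: spectrum_form_bound => // [|u Au]; first by rewrite expr1n.
  by rewrite mul1r; apply: ub_le_sup => //; exists lambda.
- move=> x; rewrite -lerN2 -mulNr -[- rform _ _]mulN1r.
  apply: spectrum_form_bound => // [|v Av]; first by rewrite sqrrN expr1n.
  rewrite mulN1r lerN2 ge_max A1l// andbT -lerBrDr.
  apply: ge_sup => [|u Au]; first by exists s.
  by have := d_le _ _ Au Av; rewrite dfin lee_fin; lra.
Qed.
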